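(* Let $B=\mathrm{PER}(K_1)^\to$ and let $j,k:B\to B$ be the nuclei $$j(R,S)=(\sigma_*R,\ \sigma_*S\cup\{(0,0)\}),\qquad k(R,S)=(S\upharpoonright\mathrm{dom}(R),\ S).$$ Let $B^{jk}$ be the arrow algebra obtained from $B$ by the nucleus $j\circ k$. Then the indexed preorder $V$ is equivalent to the tripos induced by $B^{jk}$. In particular, $V$ is a tripos.
   Context: For $m,n\in\mathbb N$ write $mn$ for the result, if defined, of applying the $m$-th partial recursive function to $n$. The indexed preorder $V$. Let $\Sigma_V:=\{(A_0,A_1,\sim):A_0\subseteq A_1\subseteq\mathbb N,\ 0\in A_1,\ \sim\text{ an equivalence relation on }A_1\}$. The functor $V:\mathbf{Set}^{\rm op}\to\mathbf{Preorder}$ sends $I$ to the set of functions $I\to\Sigma_V$; writing $\alpha(i)=(\alpha_0(i),\alpha_1(i),\sim_{\alpha(i)})$, the preorder is: $\alpha\leq_{VI}\beta$ iff there is $r\in\mathbb N$ such that for all $i\in I$: for all $n\in\alpha_1(i)$, $rn$ is defined and $rn\in\beta_1(i)$; for all $n,m\in\alpha_1(i)$, $n\sim_{\alpha(i)}m$ implies $rn\sim_{\beta(i)}rm$; and for all $n\in\alpha_0(i)$, $rn\in\beta_0(i)$. On morphisms $V$ acts by precomposition. Arrow algebras. An arrow structure is a complete poset $(A,\preccurlyeq)$ (infima $\bigwedge$, binary $\curlywedge$) with a binary operation $\to$ such that $a'\preccurlyeq a$ and $b\preccurlyeq b'$ imply $a\to b\preccurlyeq a'\to b'$. The operation $\to$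 associates to the right and binds stronger than $\bigwedge,\curlywedge$. A separator is a subset $S\subseteq A$ that is upwards closed, closed under modus ponens ($a\to b\in S$ and $a\in S$ imply $b\in S$), and contains $\mathbf k=\bigwedge_{a,b}a\to b\to a$, $\mathbf s=\bigwedge_{a,b,c}(a\to b\to c)\to(a\to b)\to(a\to c)$ and $\mathbf a=\bigwedge_{a\in A,\,B\subseteq\mathrm{Im}(\to)}(\bigwedge_{b\in B}a\to b)\to a\to\bigwedge_{b\in B}b$. An arrow algebra is an arrow structure with a separator. $\mathrm{PER}(K_1)$ is the arrow algebra of symmetric and transitive binary relations on $\mathbb N$, ordered by inclusion, with implication $$R\to S:=\{(x,x')\in\mathbb N^2:\forall(y,y')\in R\ (xy\text{ and }x'y'\text{ are defined and }(xy,x'y')\in S)\}$$ and separator the set of inhabited such relations. The arrow algebra $B=\mathrm{PER}(K_1)^\to$ has underlying set $\{(R,S)\in\mathrm{PER}(K_1)^2:R\subseteq S\}$, ordered pointwise by inclusion, with implication $(R,S)\to(U,W):=((R\to U)\cap(S\to W),\,S\to W)$ and separator the set of $(R,S)$ with $R$ inhabited. For a relation $R$ on $\mathbb N$: $\sigma_*R=\{(x+1,y+1):(x,y)\in R\}$, $\mathrm{dom}(R)=\{x:(x,x)\in R\}$, and $S\upharpoonright X=\{(x,y)\in S:x,y\in X\}$. A nucleus on an arrow algebra is a $\preccurlyeq$-monotone map $l$ with $\bigwedge_a a\to la\in S$ and $\bigwedge_{a,b}(a\to lb)\to(la\to lb)\in S$. The arrow algebra obtained from an arrow algebra $C$ with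 separator $S$ by a nucleus $l$ has the same underlying poset, implication $a\to_l b:=a\to lb$ and separator $\{a:la\in S\}$. The maps $j$, $k$ and $j\circ k$ in the claim are nuclei on $B$. The tripos induced by an arrow algebra $(A,\preccurlyeq,\to,S)$ sends a set $I$ to $A^I$ preordered by $\varphi\vdash\psi$ iff $\bigwedge_{i\in I}\varphi(i)\to\psi(i)\in S$, and acts on functions by precomposition. A ($\mathbf{Set}$-based) tripos is a pseudofunctor $P:\mathbf{Set}^{\rm op}\to\mathbf{preHeyt}$ (preorders whose poset reflection is a Heyting algebra, with monotone maps preserving finite meets, finite joins and implication up to isomorphism) such that every $Pf$ has a left adjoint $\exists_f$ and a right adjoint $\forall_f$ in preorders satisfying the Beck–Chevalley condition for pullback squares of sets, and there are a set $\Sigma$ and $\sigma\in P\Sigma$ such that every $\varphi\in PI$ is isomorphic to $P[\varphi](\sigma)$ for some function $[\varphi]:I\to\Sigma$. Two indexed preorders $\mathbf{Set}^{\rm op}\to\mathbf{Preorder}$ are equivalent if there are (pseudo)natural transformations in both directions which are mutually inverse up to isomorphism. In the presence of the axiom of choice, it is equivalent to ask for one (pseudo)natural transformation that pointwise preserves and reflects the preorder and is essentially surjective. *)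

(* Defs.v *)
From Stdlib Require Import Arith Cantor Lia RelationClasses.

Set Implicit Arguments.
Unset Strict Implicit.
Unset Printing Implicit Defensive.

(** Programs for the unary partial recursive functions.  Functions of several
    arguments are unary functions on iterated Cantor pairs, so the projections
    and pairing replace the n-ary projections and substitution of the usual
    presentation. *)
Inductive code : Type :=
| Zero : code
| Succ : code
| Fst : code
| Snd : code
| Pair : code -> code -> code
| Comp : code -> code -> code
| Prec : code -> code -> code
| Mu : code -> code.

(** [eval c n r]: program [c] terminates on input [n] with result [r].
    - [Prec f g] sends <a,0> to f a and <a,n+1> to g <a,<n,Prec f g <a,n>>>;
    - [Mu f] sends a to the least n such that f <a,n> = 0, with f <a,m> defined
      for all m < n. *)
Fixpoint eval (c : code) : nat -> nat -> Prop :=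
  match c with
  | Zero => fun _ r => r = 0
  | Succ => fun n r => r = S n
  | Fst => fun n r => r = fst (of_nat n)
  | Snd => fun n r => r = snd (of_nat n)
  | Pair f g => fun n r =>
      exists u v, eval f n u /\ eval g n v /\ r = to_nat (u, v)
  | Comp f g => fun n r => exists u, eval g n u /\ eval f u r
  | Prec f g => fun x r =>
      let a := fst (of_nat x) in
      (fix rec (n : nat) (r : nat) : Prop :=
         match n with
         | 0 => eval f a r
         | S n' => exists v, rec n' v /\ eval g (to_nat (a, to_nat (n', v))) r
         end) (snd (of_nat x)) r
  | Mu f => fun a n =>
      eval f (to_nat (a, n)) 0 /\
      forall m, m < n -> exists v, eval f (to_nat (a, m)) (S v)
  end.

Fixpoint code_index (c : code) : nat :=
  match c with
  | Zero => 0
  | Succ => 1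
  | Fst => 2
  | Snd => 3
  | Pair f g => 4 + 4 * to_nat (code_index f, code_index g)
  | Comp f g => 5 + 4 * to_nat (code_index f, code_index g)
  | Prec f g => 6 + 4 * to_nat (code_index f, code_index g)
  | Mu f => 7 + 4 * code_index f
  end.

Lemma code_index_inj c d : code_index c = code_index d -> c = d.
Proof.
revert d.
induction c as [| | | |f IHf g IHg|f IHf g IHg|f IHf g IHg|f IHf];
  intros [| | | |f' g'|f' g'|f' g'|f']; cbn [code_index]; intros H;
  try reflexivity; try (exfalso; lia).
4: now rewrite (IHf f'); [|lia].
all: assert (E : to_nat (code_index f, code_index g) =
                 to_nat (code_index f', code_index g')) by lia;
  apply to_nat_inj in E; injection E as E1 E2;
  now rewrite (IHf _ E1), (IHg _ E2).
Qed.

Lemma code_index_surj m : exists c, code_index c = m.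
Proof.
induction m as [m IH] using lt_wf_ind.
destruct (le_lt_dec 4 m) as [Hm|Hm].
- assert (Hq : exists q r, m = 4 + r + 4 * q /\ r < 4).
  { exists ((m - 4) / 4), ((m - 4) mod 4).
    pose proof (Nat.div_mod_eq (m - 4) 4).
    pose proof (Nat.mod_upper_bound (m - 4) 4). lia. }
  destruct Hq as [q [r [E Hr]]].
  destruct (of_nat q) as [x y] eqn:Exy.
  assert (Eq : to_nat (x, y) = q) by (rewrite <- Exy; apply cancel_to_of).
  pose proof (to_nat_non_decreasing x y) as Hle.
  destruct (IH x) as [c Hc]; [lia|]. destruct (IH y) as [d Hd]; [lia|].
  destruct (IH q) as [e He]; [lia|].
  destruct r as [|[|[|[|r]]]]; [exists (Pair c d)|exists (Comp c d)
    |exists (Prec c d)|exists (Mu e)|lia];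
    cbn [code_index]; rewrite ?Hc, ?Hd, ?He, ?Eq; lia.
- destruct m as [|[|[|[|m]]]]; [exists Zero|exists Succ|exists Fst|exists Snd|lia];
    reflexivity.
Qed.

Lemma eval_functional c n r r' : eval c n r -> eval c n r' -> r = r'.
Proof.
revert n r r'.
induction c as [| | | |f IHf g IHg|f IHf g IHg|f IHf g IHg|f IHf];
  simpl; intros n r r'; try congruence.
- intros [u [v [Hu [Hv ->]]]] [u' [v' [Hu' [Hv' ->]]]].
  now rewrite (IHf _ _ _ Hu Hu'), (IHg _ _ _ Hv Hv').
- intros [u [Hu Hr]] [u' [Hu' Hr']].
  rewrite (IHg _ _ _ Hu' Hu) in Hr'. eauto.
- revert r r'. induction (snd (of_nat n)) as [|m IH]; intros r r'; [apply IHf|].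
  intros [v [Hv Hr]] [v' [Hv' Hr']].
  rewrite (IH _ _ Hv' Hv) in Hr'. eauto.
- intros [Hr Hlt] [Hr' Hlt'].
  destruct (lt_eq_lt_dec r r') as [[H|H]|H]; [|exact H|].
  + destruct (Hlt' _ H) as [v Hv]. pose proof (IHf _ _ _ Hr Hv). discriminate.
  + destruct (Hlt _ H) as [v Hv]. pose proof (IHf _ _ _ Hr' Hv). discriminate.
Qed.

(** [app m n r]: the m-th partial recursive function is defined at n, with
    value r.  Since [code_index] is bijective, every m is the index of exactly
    one program. *)
Definition app (m n r : nat) : Prop :=
  exists c, code_index c = m /\ eval c n r.

Lemma app_functional m n r r' : app m n r -> app m n r' -> r = r'.
Proof.
intros [c [Hc Hr]] [d [Hd Hr']].
assert (d = c) as -> by (apply code_index_inj; congruence).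
exact (eval_functional Hr Hr').
Qed.

(** Sets are rendered as types.  The records [indexedRel] and [arrowData] carry
    only the data; the laws are the predicates [is_indexed_preorder],
    [is_tripos], [is_arrow_algebra]. *)
Record indexedRel := {
  ix_car :> Type -> Type;
  ix_le : forall I : Type, ix_car I -> ix_car I -> Prop;
  ix_map : forall I J : Type, (I -> J) -> ix_car J -> ix_car I }.

Arguments ix_le {i I} _ _.
Arguments ix_map i {I J} _ _.

Definition iso (A : Type) (le : A -> A -> Prop) (x y : A) : Prop :=
  le x y /\ le y x.

Notation ix_iso := (iso ix_le).

Definition is_indexed_preorder (P : indexedRel) : Prop :=
  (forall I (x : P I), ix_le x x) /\
  (forall I (x y z : P I), ix_le x y -> ix_le y z -> ix_le x z) /\
  (forall I J (f : I -> J) (x y : P J),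
     ix_le x y -> ix_le (ix_map P f x) (ix_map P f y)) /\
  (forall I (x : P I), ix_iso (ix_map P (fun i => i) x) x) /\
  (forall I J K (f : I -> J) (g : J -> K) (x : P K),
     ix_iso (ix_map P (fun i => g (f i)) x) (ix_map P f (ix_map P g x))).

Definition is_transformation (P Q : indexedRel) (F : forall I, P I -> Q I) : Prop :=
  (forall I (x y : P I), ix_le x y -> ix_le (F I x) (F I y)) /\
  (forall I J (f : I -> J) (x : P J),
     ix_iso (F I (ix_map P f x)) (ix_map Q f (F J x))).

Definition equivalent (P Q : indexedRel) : Prop :=
  is_indexed_preorder P /\ is_indexed_preorder Q /\
  exists (F : forall I, P I -> Q I) (G : forall I, Q I -> P I),
    is_transformation F /\ is_transformation G /\
    (forall I (x : P I), ix_iso (G I (F I x)) x) /\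
    (forall I (y : Q I), ix_iso (F I (G I y)) y).

Section PreHeyting.
Variables (A : Type) (le : A -> A -> Prop).

Definition is_top (t : A) := forall x, le x t.
Definition is_bot (b : A) := forall x, le b x.
Definition is_meet (x y m : A) := forall z, le z m <-> le z x /\ le z y.
Definition is_join (x y u : A) := forall z, le u z <-> le x z /\ le y z.
Definition is_impl (x y h : A) :=
  forall z m, is_meet z x m -> (le z h <-> le m y).

Definition is_preHeyt : Prop :=
  (forall x, le x x) /\
  (forall x y z, le x y -> le y z -> le x z) /\
  (exists t, is_top t) /\
  (exists b, is_bot b) /\
  (forall x y, exists m, is_meet x y m) /\
  (forall x y, exists u, is_join x y u) /\
  (forall x y, exists h, is_impl x y h).
End PreHeyting.

Definition is_preHeyt_morphism (A A' : Type) (le : A -> A -> Prop)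
    (le' : A' -> A' -> Prop) (h : A -> A') : Prop :=
  (forall x y, le x y -> le' (h x) (h y)) /\
  (forall t, is_top le t -> is_top le' (h t)) /\
  (forall b, is_bot le b -> is_bot le' (h b)) /\
  (forall x y m, is_meet le x y m -> is_meet le' (h x) (h y) (h m)) /\
  (forall x y u, is_join le x y u -> is_join le' (h x) (h y) (h u)) /\
  (forall x y z, is_impl le x y z -> is_impl le' (h x) (h y) (h z)).

Definition adjoint (A A' : Type) (le : A -> A -> Prop) (le' : A' -> A' -> Prop)
    (l : A -> A') (r : A' -> A) : Prop :=
  (forall x y, le x y -> le' (l x) (l y)) /\
  (forall x y, le' x y -> le (r x) (r y)) /\
  (forall x y, le' (l x) y <-> le x (r y)).

(**    L --p--> I
       |q       |f
       K --g--> J   *)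
Definition is_pullback (I J K L : Type)
    (f : I -> J) (g : K -> J) (p : L -> I) (q : L -> K) : Prop :=
  (forall l, f (p l) = g (q l)) /\
  (forall i k, f i = g k -> exists! l, p l = i /\ q l = k).

(** Adjoints are unique up to isomorphism, so the Beck-Chevalley condition may
    be required of all choices of adjoints. *)
Definition is_tripos (P : indexedRel) : Prop :=
  is_indexed_preorder P /\
  (forall I, is_preHeyt (@ix_le P I)) /\
  (forall I J (f : I -> J),
     is_preHeyt_morphism (@ix_le P J) (@ix_le P I) (ix_map P f)) /\
  (forall I J (f : I -> J),
     (exists E : P I -> P J, adjoint ix_le ix_le E (ix_map P f)) /\
     (exists A : P I -> P J, adjoint ix_le ix_le (ix_map P f) A)) /\
  (forall I J K L (f : I -> J) (g : K -> J) (p : L -> I) (q : L -> K),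
     is_pullback f g p q ->
     (forall (Ef : P I -> P J) (Eq : P L -> P K),
        adjoint ix_le ix_le Ef (ix_map P f) ->
        adjoint ix_le ix_le Eq (ix_map P q) ->
        forall x, ix_iso (Eq (ix_map P p x)) (ix_map P g (Ef x))) /\
     (forall (Af : P I -> P J) (Aq : P L -> P K),
        adjoint ix_le ix_le (ix_map P f) Af ->
        adjoint ix_le ix_le (ix_map P q) Aq ->
        forall x, ix_iso (Aq (ix_map P p x)) (ix_map P g (Af x)))) /\
  (exists (Sigma : Type) (s : P Sigma),
     forall I (x : P I), exists h : I -> Sigma, ix_iso x (ix_map P h s)).

Record arrowData := {
  arr_car :> Type;
  arr_le : arr_car -> arr_car -> Prop;
  arr_inf : (arr_car -> Prop) -> arr_car;
  arr_imp : arr_car -> arr_car -> arr_car;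
  arr_sep : arr_car -> Prop }.

Arguments arr_le {a} _ _.
Arguments arr_inf {a} _.
Arguments arr_imp {a} _ _.
Arguments arr_sep {a} _.

Section ArrowAlgebra.
Variable A : arrowData.
Local Infix "⇒" := (@arr_imp A) (at level 55, right associativity).

Definition comb_k : A := arr_inf (fun x => exists a b, x = (a ⇒ b ⇒ a)).

Definition comb_s : A :=
  arr_inf (fun x => exists a b c,
    x = ((a ⇒ b ⇒ c) ⇒ (a ⇒ b) ⇒ (a ⇒ c))).

Definition comb_a : A :=
  arr_inf (fun x => exists (a : A) (X : A -> Prop),
    (forall b, X b -> exists c d, b = (c ⇒ d)) /\
    x = (arr_inf (fun y => exists b, X b /\ y = (a ⇒ b)) ⇒ a ⇒ arr_inf X)).

Definition is_arrow_structure : Prop :=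
  (forall a : A, arr_le a a) /\
  (forall a b c : A, arr_le a b -> arr_le b c -> arr_le a c) /\
  (forall a b : A, arr_le a b -> arr_le b a -> a = b) /\
  (forall (X : A -> Prop) (a : A),
     arr_le a (arr_inf X) <-> forall x, X x -> arr_le a x) /\
  (forall a a' b b' : A,
     arr_le a' a -> arr_le b b' -> arr_le (a ⇒ b) (a' ⇒ b')).

Definition is_separator (T : A -> Prop) : Prop :=
  (forall a b, T a -> arr_le a b -> T b) /\
  (forall a b, T (a ⇒ b) -> T a -> T b) /\
  T comb_k /\ T comb_s /\ T comb_a.

Definition is_arrow_algebra : Prop :=
  is_arrow_structure /\ is_separator (@arr_sep A).

Definition is_nucleus (l : A -> A) : Prop :=
  (forall a b, arr_le a b -> arr_le (l a) (l b)) /\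
  arr_sep (arr_inf (fun x => exists a, x = (a ⇒ l a))) /\
  arr_sep (arr_inf (fun x => exists a b, x = ((a ⇒ l b) ⇒ (l a ⇒ l b)))).

Definition nucleus_algebra (l : A -> A) : arrowData :=
  {| arr_car := A;
     arr_le := arr_le;
     arr_inf := arr_inf;
     arr_imp := fun a b => a ⇒ l b;
     arr_sep := fun a => arr_sep (l a) |}.

Definition induced : indexedRel :=
  {| ix_car := fun I => I -> A;
     ix_le := fun I phi psi =>
       arr_sep (arr_inf (fun x => exists i, x = (phi i ⇒ psi i)));
     ix_map := fun I J f phi i => phi (f i) |}.
End ArrowAlgebra.

Record per := {
  per_rel :> nat -> nat -> Prop;
  per_PER : PER per_rel }.

Definition per_le (R S : per) : Prop := forall x y, R x y -> S x y.

#[local] Obligation Tactic := idtac.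

Program Definition per_inf (X : per -> Prop) : per :=
  {| per_rel := fun x y => forall R, X R -> R x y |}.
Next Obligation.
intros X; split.
- intros x y H R HR. pose proof (per_PER R). symmetry. now apply H.
- intros x y z H H' R HR. pose proof (per_PER R). transitivity y; auto.
Qed.

Program Definition per_meet (R S : per) : per :=
  {| per_rel := fun x y => R x y /\ S x y |}.
Next Obligation.
intros R S; pose proof (per_PER R) as HR; pose proof (per_PER S) as HS. split.
- intros x y [H H']. split; now symmetry.
- intros x y z [H H'] [K K']. split; now transitivity y.
Qed.

Program Definition per_imp (R S : per) : per :=
  {| per_rel := fun x x' => forall y y', R y y' ->
       exists u u', app x y u /\ app x' y' u' /\ S u u' |}.
Next Obligation.
intros R S; pose proof (per_PER R) as HR; pose proof (per_PER S) as HS. split.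
- intros x x' H1 y y' Hy. symmetry in Hy.
  destruct (H1 _ _ Hy) as [u [u' [Hu [Hu' Huu]]]].
  exists u', u. repeat split; auto. now symmetry.
- intros x x' x'' H1 H2 y y' Hy.
  assert (Hyy : R y y) by (transitivity y'; [|symmetry]; exact Hy).
  destruct (H1 _ _ Hyy) as [u [u' [Hu [Hu' Huu]]]].
  destruct (H2 _ _ Hy) as [v [v' [Hv [Hv' Hvv]]]].
  rewrite (app_functional Hv Hu') in Hvv.
  exists u, v'. repeat split; auto. now transitivity u'.
Qed.

Definition per_inhabited (R : per) : Prop := exists x y, R x y.

Definition PER_K1 : arrowData :=
  {| arr_car := per;
     arr_le := per_le;
     arr_inf := per_inf;
     arr_imp := per_imp;
     arr_sep := per_inhabited |}.

Record per_arrow := {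
  src : PER_K1;
  tgt : PER_K1;
  src_tgt : arr_le src tgt }.

Definition per_arrow_le (a b : per_arrow) : Prop :=
  arr_le (src a) (src b) /\ arr_le (tgt a) (tgt b).

Program Definition per_arrow_inf (X : per_arrow -> Prop) : per_arrow :=
  {| src := arr_inf (fun R => exists a, X a /\ R = src a);
     tgt := arr_inf (fun S => exists a, X a /\ S = tgt a) |}.
Next Obligation.
intros X x y H S [a [Ha ->]]. apply (src_tgt (p := a)).
apply H. exists a. auto.
Qed.

Program Definition per_arrow_imp (a b : per_arrow) : per_arrow :=
  {| src := per_meet (arr_imp (src a) (src b)) (arr_imp (tgt a) (tgt b));
     tgt := arr_imp (tgt a) (tgt b) |}.
Next Obligation.
intros a b x y [_ H]. exact H.
Qed.

Definition B : arrowData :=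
  {| arr_car := per_arrow;
     arr_le := per_arrow_le;
     arr_inf := per_arrow_inf;
     arr_imp := per_arrow_imp;
     arr_sep := fun a => arr_sep (src a) |}.

Definition sigma_star (R : nat -> nat -> Prop) : nat -> nat -> Prop :=
  fun x y => exists x' y', x = S x' /\ y = S y' /\ R x' y'.

Definition dom (R : nat -> nat -> Prop) : nat -> Prop := fun x => R x x.

Definition restrict (S : nat -> nat -> Prop) (X : nat -> Prop) :
    nat -> nat -> Prop :=
  fun x y => S x y /\ X x /\ X y.

Program Definition per_shift (R : per) : per :=
  {| per_rel := sigma_star R |}.
Next Obligation.
intros R; pose proof (per_PER R) as HR. split.
- intros x y [a [b [-> [-> Hab]]]]. exists b, a. repeat split. now symmetry.
- intros x y z [a [b [-> [-> Hab]]]] [b' [c [E [-> Hbc]]]].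
  injection E as <-. exists a, c. repeat split. now transitivity b.
Qed.

Program Definition per_shift0 (R : per) : per :=
  {| per_rel := fun x y => sigma_star R x y \/ (x = 0 /\ y = 0) |}.
Next Obligation.
intros R; pose proof (per_PER (per_shift R)) as HR; simpl in HR. split.
- intros x y [H|[-> ->]]; [left; now symmetry|right; auto].
- intros x y z [H|[-> ->]] [H'|[E ->]].
  + left. now transitivity y.
  + destruct H as [? [? [_ [E' _]]]]. congruence.
  + now left.
  + right; auto.
Qed.

Program Definition per_restrict (S : per) (X : nat -> Prop) : per :=
  {| per_rel := restrict S X |}.
Next Obligation.
intros S X; pose proof (per_PER S) as HS. split.
- intros x y [H1 [H2 H3]]. repeat split; auto. now symmetry.
- intros x y z [H1 [H2 H3]] [H4 [H5 H6]]. repeat split; auto. now transitivity y.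
Qed.

Program Definition nucleus_j (a : B) : B :=
  {| src := per_shift (src a); tgt := per_shift0 (tgt a) |}.
Next Obligation.
intros a x y [x' [y' [-> [-> H]]]]. left. exists x', y'. repeat split.
now apply (src_tgt (p := a)).
Qed.

Program Definition nucleus_k (a : B) : B :=
  {| src := per_restrict (tgt a) (dom (per_rel (src a))); tgt := tgt a |}.
Next Obligation.
intros a x y [H _]. exact H.
Qed.

Definition nucleus_jk (a : B) : B := nucleus_j (nucleus_k a).

Definition B_jk : arrowData := nucleus_algebra nucleus_jk.

(** The relation is required to be contained in A_1 × A_1. *)
Record Sigma_V := {
  sv0 : nat -> Prop;
  sv1 : nat -> Prop;
  sv_rel : nat -> nat -> Prop;
  sv_sub : forall n, sv0 n -> sv1 n;
  sv_zero : sv1 0;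
  sv_field : forall n m, sv_rel n m -> sv1 n /\ sv1 m;
  sv_refl : forall n, sv1 n -> sv_rel n n;
  sv_sym : forall n m, sv_rel n m -> sv_rel m n;
  sv_trans : forall n m p, sv_rel n m -> sv_rel m p -> sv_rel n p }.

Definition V_le (I : Type) (alpha beta : I -> Sigma_V) : Prop :=
  exists r : nat, forall i : I,
    (forall n, sv1 (alpha i) n -> exists v, app r n v /\ sv1 (beta i) v) /\
    (forall n m, sv1 (alpha i) n -> sv1 (alpha i) m -> sv_rel (alpha i) n m ->
       exists v w, app r n v /\ app r m w /\ sv_rel (beta i) v w) /\
    (forall n, sv0 (alpha i) n -> exists v, app r n v /\ sv0 (beta i) v).

Definition V : indexedRel :=
  {| ix_car := fun I => I -> Sigma_V;
     ix_le := V_le;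
     ix_map := fun I J f alpha i => alpha (f i) |}.

(* Main.v *)
From Stdlib Require Import Arith Cantor Lia RelationClasses.
From Stdlib Require Import FunctionalExtensionality PropExtensionality ProofIrrelevance.
Require Import Defs.

(** An element of [B] is a pair [R ⊆ S] of partial equivalence relations.  Read it
    as one relation varying over two stages, [R] now and [S] later: implication in
    [B] is then Kripke implication, each stage quantifying over the stages from it
    on ([at_imp]).  A membership in the separator asks for one program that works
    uniformly at both stages and over all members of an infimum.  Such programs are
    written below as λ-terms over a context, and checked by the typing rules for
    [Γ ⊢ t ∈ a].  The rules for application and abstraction rest on a universal
    program and on the computability of closures.

    In these terms a nucleus [l] is a strong monad: programs of types [a ⇒ l a] and
    [(a ⇒ l b) ⊗ l a ⇒ l b], uniform in [a] and [b] ([nucleus_iff]).  The separator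
    of the algebra of [l] contains its three combinators because [λxy.x], [λxyz.xz(yz)]
    and [λxyz.xyz] can be written in monadic style ([nucleus_arrow_algebra]); the
    identity nucleus gives [B] itself.  The nucleus [j] adds an exceptional value 0
    at the later stage, [k] is idempotent, and [k j ≼ j k] is the distributive law
    that makes [j k] a nucleus ([nucleus_terms_comp]).

    A preorder on families [I -> Φ] is a tripos as soon as [Φ] has finite meets and
    an operation [imp a X], to be thought of as: [a] implies every member of [X].
    Implication and [∀] are instances of it, disjunction and [∃] are obtained from
    these by impredicative encodings, and the Beck-Chevalley condition for [∃]
    follows from that for [∀] by transposing adjoints ([pointwise_tripos]).  For a
    nucleus on [B], pairing gives meets and [imp a X] is the infimum of the
    [a ⇒ l b] with [b] in [X].

    Finally, [(A0, A1, ~)] is sent to the pair of [~] restricted to [A0] and [~].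
    A morphism into [l b] for [l] the nucleus [j k] computes in [~] shifted by one,
    with 0 as an extra value at the later stage.  The successor turns a tracker in
    [V] into such a morphism, and the predecessor turns it back, sending the extra
    value to the element 0 that every [A1] contains ([B_of_V_full]).  Every [b] is
    isomorphic to [j k b], which is in the image up to isomorphism.  So the two
    indexed preorders are equivalent, and the operation [imp] transports to [V]. *)

Set Implicit Arguments.
Unset Strict Implicit.
Unset Printing Implicit Defensive.

#[local] Obligation Tactic := idtac.

Arguments to_nat : simpl never.
Arguments of_nat : simpl never.

Notation "⟨ x , y ⟩" := (to_nat (x, y)) (at level 0, x at level 99, y at level 99).
Notation π₁ n := (fst (of_nat n)).
Notation π₂ n := (snd (of_nat n)).

(** * Computable functions *)

Definition computable (f : nat -> nat) : Type := {c | forall n, eval c n (f n)}.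

Definition ncase (n z : nat) (s : nat -> nat) : nat :=
  match n with 0 => z | S m => s m end.

Definition Id : code := Pair Fst Snd.

Lemma pair_proj n : ⟨π₁ n, π₂ n⟩ = n.
Proof. rewrite <- surjective_pairing. apply cancel_to_of. Qed.

Lemma eval_Id n : eval Id n n.
Proof. exists (π₁ n), (π₂ n). now rewrite pair_proj. Qed.

Lemma computable_id : computable (fun x => x).
Proof. exists Id. exact eval_Id. Qed.

Fixpoint Const (n : nat) : code :=
  match n with 0 => Zero | S m => Comp Succ (Const m) end.

Lemma eval_Const n x : eval (Const n) x n.
Proof. induction n as [|n IH]; [reflexivity|]. now exists n. Qed.

Lemma computable_const n : computable (fun _ => n).
Proof. exists (Const n). intros x. apply eval_Const. Qed.

Lemma computable_S f : computable f -> computable (fun x => S (f x)).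
Proof. intros [c H]. exists (Comp Succ c). intros n. now exists (f n). Qed.

Lemma computable_fst f : computable f -> computable (fun x => π₁ (f x)).
Proof. intros [c H]. exists (Comp Fst c). intros n. now exists (f n). Qed.

Lemma computable_snd f : computable f -> computable (fun x => π₂ (f x)).
Proof. intros [c H]. exists (Comp Snd c). intros n. now exists (f n). Qed.

Lemma computable_pair f g :
  computable f -> computable g -> computable (fun x => ⟨f x, g x⟩).
Proof. intros [c H] [d K]. exists (Pair c d). intros n. now exists (f n), (g n). Qed.

Lemma computable_comp f g :
  computable f -> computable g -> computable (fun x => f (g x)).
Proof. intros [c H] [d K]. exists (Comp c d). intros n. exists (g n). now split. Qed.

Lemma eval_Prec_O f g a r : eval f a r -> eval (Prec f g) ⟨a, 0⟩ r.
Proof. intros H. cbn [eval]. now rewrite cancel_of_to. Qed.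

Lemma eval_Prec_S f g a n v r :
  eval (Prec f g) ⟨a, n⟩ v -> eval g ⟨a, ⟨n, v⟩⟩ r -> eval (Prec f g) ⟨a, S n⟩ r.
Proof. cbn [eval]. rewrite !cancel_of_to. intros H K. now exists v. Qed.

(** The accumulator of [Prec] is used and its counter is discarded. *)
Lemma computable_iter h f g :
  computable h -> computable f -> computable (fun p => g (π₁ p) (π₂ p)) ->
  computable (fun x => Nat.iter (h x) (g x) (f x)).
Proof.
intros [ch Hh] [cf Hf] [cg Hg].
exists (Comp (Prec cf (Comp cg (Pair Fst (Comp Snd Snd)))) (Pair Id ch)).
intros x. exists ⟨x, h x⟩. split.
- exists x, (h x). auto using eval_Id.
- induction (h x) as [|n IH].
  + now apply eval_Prec_O.
  + apply (eval_Prec_S IH). set (v := Nat.iter n (g x) (f x)).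
    exists ⟨x, v⟩. split.
    * exists x, v. cbn. rewrite !cancel_of_to. cbn.
      repeat split. exists ⟨n, v⟩. rewrite ?cancel_of_to. auto.
    * generalize (Hg ⟨x, v⟩). rewrite cancel_of_to. auto.
Qed.

(** The counter of [Prec] is used and its accumulator is discarded.  Both branches
    have to be total, since [Prec] runs through all the smaller values. *)
Lemma computable_case h f g :
  computable h -> computable f -> computable (fun p => g (π₁ p) (π₂ p)) ->
  computable (fun x => ncase (h x) (f x) (g x)).
Proof.
intros [ch Hh] [cf Hf] [cg Hg].
exists (Comp (Prec cf (Comp cg (Pair Fst (Comp Fst Snd)))) (Pair Id ch)).
intros x. exists ⟨x, h x⟩. split.
- exists x, (h x). auto using eval_Id.
- induction (h x) as [|n IH].
  + now apply eval_Prec_O.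
  + apply (eval_Prec_S IH). set (v := ncase n (f x) (g x)).
    exists ⟨x, n⟩. split.
    * exists x, n. cbn. rewrite !cancel_of_to. cbn.
      repeat split. exists ⟨n, v⟩. rewrite ?cancel_of_to. auto.
    * generalize (Hg ⟨x, n⟩). rewrite cancel_of_to. auto.
Qed.

Ltac computability :=
  cbv beta zeta;
  lazymatch goal with
  | |- computable (fun x => x) => exact computable_id
  | |- computable (fun x => π₁ _) => apply computable_fst; computability
  | |- computable (fun x => π₂ _) => apply computable_snd; computability
  | |- computable (fun x => ⟨_, _⟩) => apply computable_pair; computability
  | |- computable (fun x => ncase _ _ _) => apply computable_case; computability
  | |- computable (fun x => Nat.iter _ _ _) => apply computable_iter; computability
  | |- computable (fun _ => ?n) => exact (computable_const n)
  | |- computable (fun x => S _) => apply computable_S; computability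
  | |- computable (fun x => ?f _) => apply (@computable_comp f); [assumption|computability]
  | |- computable _ => assumption
  end.

(** * A universal program *)

(** Quotient and remainder by 4, as a pair: they recover the outermost constructor of
    a program and the code of its arguments from its index, where the quotient is
    0 exactly for the four constructors without arguments. *)
Definition divmod4 (n : nat) : nat :=
  Nat.iter n
    (fun p => ncase (π₂ p) ⟨π₁ p, 1⟩ (fun r => ncase r ⟨π₁ p, 2⟩
       (fun r => ncase r ⟨π₁ p, 3⟩ (fun _ => ⟨S (π₁ p), 0⟩))))
    ⟨0, 0⟩.

Lemma divmod4_spec n q r : n = r + 4 * q -> r < 4 -> divmod4 n = ⟨q, r⟩.
Proof.
intros -> Hr.
assert (E : divmod4 (4 * q) = ⟨q, 0⟩).
{ induction q as [|q IH]; [reflexivity|].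
  replace (4 * S q) with (4 + 4 * q) by lia. unfold divmod4 in *.
  rewrite Nat.iter_add, IH. cbn [Nat.iter nat_rect].
  now repeat (rewrite !cancel_of_to; cbn [fst snd ncase]). }
unfold divmod4 in *. rewrite Nat.iter_add, E.
destruct r as [|[|[|[|r]]]]; [| | | |lia]; cbn [Nat.iter nat_rect];
  now repeat (rewrite !cancel_of_to; cbn [fst snd ncase]).
Qed.

(** The interpreter is a stack machine.  A state is a pair of a stack and a current
    value; a stack is 0 when empty, and otherwise a successor ([push]).  Each frame
    tells what to do with the current value [v]:
    - [frame_run c]: run the program of index [c] on [v];
    - [frame_second g n]: remember [v] and run [g] on [n];
    - [frame_pair u]: return [⟨u, v⟩];
    - [frame_search f a i]: [v] is the value of [f] at [⟨a, i⟩]; return [i] if it is 0,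
      and otherwise try [i + 1]. *)
Definition frame_run c := ⟨0, c⟩.
Definition frame_second g n := ⟨1, ⟨g, n⟩⟩.
Definition frame_pair u := ⟨2, u⟩.
Definition frame_search f a i := ⟨3, ⟨f, ⟨a, i⟩⟩⟩.
Definition push fr k := S ⟨fr, k⟩.

Definition run_step (c v k : nat) : nat :=
  ncase (π₁ (divmod4 c))
    (ncase (π₂ (divmod4 c)) ⟨k, 0⟩ (fun r =>
     ncase r ⟨k, S v⟩ (fun r =>
     ncase r ⟨k, π₁ v⟩ (fun _ => ⟨k, π₂ v⟩))))
    (fun d =>
     ncase (π₂ (divmod4 c))
       ⟨push (frame_run (π₁ d)) (push (frame_second (π₂ d) v) k), v⟩ (fun r =>
     ncase r
       ⟨push (frame_run (π₂ d)) (push (frame_run (π₁ d)) k), v⟩ (fun r =>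
     ncase r
       (ncase (π₂ v)
          ⟨push (frame_run (π₁ d)) k, π₁ v⟩
          (fun n => ⟨push (frame_run c) (push (frame_pair n)
                       (push (frame_pair (π₁ v)) (push (frame_run (π₂ d)) k))),
                     ⟨π₁ v, n⟩⟩)) (fun _ =>
       ⟨push (frame_run d) (push (frame_search d v 0) k), ⟨v, 0⟩⟩)))).

Definition pop_step (fr v k : nat) : nat :=
  let d := π₂ fr in
  ncase (π₁ fr) (run_step d v k) (fun t =>
  ncase t ⟨push (frame_run (π₁ d)) (push (frame_pair v) k), π₂ d⟩ (fun t =>
  ncase t ⟨k, ⟨d, v⟩⟩ (fun _ =>
    let f := π₁ d in let a := π₁ (π₂ d) in let i := π₂ (π₂ d) in
    ncase v ⟨k, i⟩
      (fun _ => ⟨push (frame_run f) (push (frame_search f a (S i)) k), ⟨a, S i⟩⟩)))).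

Definition step (s : nat) : nat :=
  ncase (π₁ s) s (fun p => pop_step (π₁ p) (π₂ s) (π₂ p)).

Lemma computable_divmod4 : computable divmod4.
Proof. unfold divmod4. computability. Qed.

(** [step] has no recursion beyond [divmod4], so it is assembled from the closure
    properties above. *)
Lemma computable_step : computable step.
Proof.
pose proof computable_divmod4.
unfold step, pop_step, run_step, push, frame_run, frame_second, frame_pair,
  frame_search.
computability.
Qed.

Definition reaches (s s' : nat) : Prop := exists n, Nat.iter n step s = s'.

Lemma reaches_trans s s' s'' : reaches s s' -> reaches s' s'' -> reaches s s''.
Proof. intros [n Hn] [m Hm]. exists (m + n). now rewrite Nat.iter_add, Hn. Qed.

Lemma reaches_step s s' s'' : step s = s' -> reaches s' s'' -> reaches s s''.
Proof. intros H. apply reaches_trans. now exists 1. Qed.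

Lemma step_push fr k v : step ⟨push fr k, v⟩ = pop_step fr v k.
Proof. unfold step, push. rewrite cancel_of_to. cbn. now rewrite cancel_of_to. Qed.

Lemma step_run c k v : step ⟨push (frame_run c) k, v⟩ = run_step c v k.
Proof. rewrite step_push. unfold pop_step, frame_run. now rewrite cancel_of_to. Qed.

Lemma step_second g n k v :
  step ⟨push (frame_second g n) k, v⟩ = ⟨push (frame_run g) (push (frame_pair v) k), n⟩.
Proof.
rewrite step_push. unfold pop_step, frame_second.
rewrite !cancel_of_to. cbn. now rewrite cancel_of_to.
Qed.

Lemma step_pair u k v : step ⟨push (frame_pair u) k, v⟩ = ⟨k, ⟨u, v⟩⟩.
Proof. rewrite step_push. unfold pop_step, frame_pair. now rewrite cancel_of_to. Qed.

Lemma step_search f a i k v :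
  step ⟨push (frame_search f a i) k, v⟩ =
  ncase v ⟨k, i⟩
    (fun _ => ⟨push (frame_run f) (push (frame_search f a (S i)) k), ⟨a, S i⟩⟩).
Proof.
rewrite step_push. unfold pop_step, frame_search.
rewrite !cancel_of_to. cbn. rewrite cancel_of_to. cbn. now rewrite cancel_of_to.
Qed.

Lemma step_Prec f g k v :
  step ⟨push (frame_run (code_index (Prec f g))) k, v⟩ =
  ncase (π₂ v) ⟨push (frame_run (code_index f)) k, π₁ v⟩
    (fun n => ⟨push (frame_run (code_index (Prec f g))) (push (frame_pair n)
                 (push (frame_pair (π₁ v)) (push (frame_run (code_index g)) k))),
               ⟨π₁ v, n⟩⟩).
Proof.
rewrite step_run. unfold run_step. cbn [code_index].
rewrite (@divmod4_spec _ (S ⟨code_index f, code_index g⟩) 2), !cancel_of_to by lia.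
cbn [fst snd ncase]. now rewrite cancel_of_to.
Qed.

(** The rest [k] of the stack is arbitrary, so that the induction hypotheses apply to
    the programs that [c] calls with further frames below them. *)
Lemma machine_correct c n r k :
  eval c n r -> reaches ⟨push (frame_run (code_index c)) k, n⟩ ⟨k, r⟩.
Proof.
revert n r k.
induction c as [| | | |f IHf g IHg|f IHf g IHg|f IHf g IHg|f IHf];
  intros n r k H; cbn [eval] in H.
7: {
  rewrite <- (pair_proj n). revert H.
  set (a := π₁ n). generalize (π₂ n) as m.
  intros m. revert r k. induction m as [|m IHm]; intros r k H.
  + eapply reaches_step; [apply step_Prec|].
    rewrite cancel_of_to. now apply IHf.
  + destruct H as [v [Hv Hr]].
    eapply reaches_step; [apply step_Prec|].
    rewrite cancel_of_to. cbn [fst snd ncase].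
    eapply reaches_trans; [apply IHm, Hv|].
    eapply reaches_step; [apply step_pair|].
    eapply reaches_step; [apply step_pair|].
    now apply IHg.
}
all: eapply reaches_step; [apply step_run|]; unfold run_step; cbn [code_index].
- rewrite (@divmod4_spec _ 0 0), !cancel_of_to by lia. exists 0. now rewrite H.
- rewrite (@divmod4_spec _ 0 1), !cancel_of_to by lia. exists 0. now rewrite H.
- rewrite (@divmod4_spec _ 0 2), !cancel_of_to by lia. exists 0. now rewrite H.
- rewrite (@divmod4_spec _ 0 3), !cancel_of_to by lia. exists 0. now rewrite H.
- destruct H as [u [v [Hu [Hv ->]]]].
  rewrite (@divmod4_spec _ (S ⟨code_index f, code_index g⟩) 0), !cancel_of_to by lia.
  cbn [fst snd ncase]. rewrite cancel_of_to.
  eapply reaches_trans; [apply IHf, Hu|].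
  eapply reaches_step; [apply step_second|].
  eapply reaches_trans; [apply IHg, Hv|].
  eapply reaches_step; [apply step_pair|]. now exists 0.
- destruct H as [u [Hu Hr]].
  rewrite (@divmod4_spec _ (S ⟨code_index f, code_index g⟩) 1), !cancel_of_to by lia.
  cbn [fst snd ncase]. rewrite cancel_of_to.
  eapply reaches_trans; [apply IHg, Hu|]. now apply IHf.
- destruct H as [Hr Hlt].
  rewrite (@divmod4_spec _ (S (code_index f)) 3), !cancel_of_to by lia. cbn [fst snd ncase].
  (* Upward search from [i], by induction on the distance [m] to the least zero. *)
  assert (L : forall m i, m + i = r ->
    reaches ⟨push (frame_run (code_index f))
               (push (frame_search (code_index f) n i) k), ⟨n, i⟩⟩ ⟨k, r⟩).
  { induction m as [|m IHm]; intros i Hi.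
    - cbn in Hi. subst i. eapply reaches_trans; [apply IHf, Hr|].
      eapply reaches_step; [apply step_search|]. now exists 0.
    - destruct (Hlt i) as [v Hv]; [lia|].
      eapply reaches_trans; [apply IHf, Hv|].
      eapply reaches_step; [apply step_search|]. apply IHm. lia. }
  apply (L r 0). lia.
Qed.

Lemma least_zero (f : nat -> nat) N :
  f N = 0 -> exists M, M <= N /\ f M = 0 /\ forall K, K < M -> f K <> 0.
Proof.
revert f. induction N as [|N IH]; intros f H.
- exists 0. repeat split; auto. lia.
- destruct (Nat.eq_dec (f 0) 0) as [H0|H0].
  + exists 0. repeat split; auto; lia.
  + destruct (IH (fun n => f (S n)) H) as [M [HM [HfM Hmin]]].
    exists (S M). repeat split; [lia|exact HfM|].
    intros [|K] HK; [exact H0|]. apply Hmin. lia.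
Qed.

(** Run the machine from [frame_run m] on [n], look for the first time at which the
    stack is empty, and read off the value.  The state does not change once the stack
    is empty, so the first such time gives the same value as any other. *)
Lemma universal : {u | forall m n r, app m n r -> eval u ⟨m, n⟩ r}.
Proof.
pose (state := fun x N => Nat.iter N step ⟨push (frame_run (π₁ x)) 0, π₂ x⟩).
assert (Hs : computable (fun p => state (π₁ p) (π₂ p))).
{ pose proof computable_step. unfold state, push, frame_run. computability. }
destruct (computable_fst Hs) as [halt Hhalt].
destruct (computable_snd Hs) as [out Hout].
exists (Comp out (Pair Id (Mu halt))).
intros m n r [c [<- Hc]].
destruct (machine_correct 0 Hc) as [N HN].
assert (HsN : state ⟨code_index c, n⟩ N = ⟨0, r⟩).
{ unfold state. rewrite cancel_of_to. exact HN. }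
clear HN. set (x := ⟨code_index c, n⟩) in *.
destruct (@least_zero (fun M => π₁ (state x M)) N) as [N0 [HN0 [H0 Hmin]]].
{ now rewrite HsN, cancel_of_to. }
assert (Hstop : state x N = state x N0).
{ replace N with ((N - N0) + N0) by lia. unfold state in *.
  rewrite Nat.iter_add. induction (N - N0) as [|d IH]; [reflexivity|].
  cbn [Nat.iter nat_rect]. unfold Nat.iter in *. rewrite IH.
  unfold step at 1. now rewrite H0. }
exists ⟨x, N0⟩. split.
- exists x, N0. split; [apply eval_Id|]. split; [split|reflexivity].
  + rewrite <- H0. generalize (Hhalt ⟨x, N0⟩). now rewrite cancel_of_to.
  + intros M HM. specialize (Hmin M HM).
    exists (pred (π₁ (state x M))). generalize (Hhalt ⟨x, M⟩).
    rewrite cancel_of_to. cbn [fst snd]. now destruct (π₁ (state x M)).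
- generalize (Hout ⟨x, N0⟩). rewrite cancel_of_to. cbn [fst snd].
  now rewrite <- Hstop, HsN, cancel_of_to.
Qed.

(** * Application and abstraction of programs *)

Definition App (t u : code) : code := Comp (proj1_sig universal) (Pair t u).

Lemma eval_App t u γ m n r :
  eval t γ m -> eval u γ n -> app m n r -> eval (App t u) γ r.
Proof.
intros Ht Hu H. exists ⟨m, n⟩. split; [now exists m, n|].
now apply (proj2_sig universal).
Qed.

Lemma computable_affine k f : computable f -> computable (fun x => k + 4 * f x).
Proof.
intros Hf.
assert (H : computable (fun x =>
  Nat.iter (f x) (fun v => S (S (S (S v)))) k)) by computability.
destruct H as [c Hc]. exists c. intros n. generalize (Hc n).
replace (Nat.iter (f n) (fun v => S (S (S (S v)))) k) with (k + 4 * f n); [easy|].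
induction (f n) as [|m IH]; [cbn; lia|]. rewrite Nat.iter_succ, <- IH. lia.
Qed.

(** The index of the program [x ↦ t ⟨γ, x⟩].  The parameter [γ] enters through
    [Const γ], whose index is computed by iteration. *)
Definition closure (t : code) (γ : nat) : nat :=
  code_index (Comp t (Pair (Const γ) Id)).

Lemma computable_closure t : computable (closure t).
Proof.
assert (H5 : computable (fun x => 5 + 4 * x)) by apply computable_affine, computable_id.
assert (Hc : computable (fun n => code_index (Const n))).
{ assert (H : computable (fun n => Nat.iter n (fun p => (fun x => 5 + 4 * x) ⟨1, p⟩) 0)).
  { apply computable_iter; [computability|computability|].
    apply (@computable_comp (fun x => 5 + 4 * x)); [exact H5|computability]. }
  destruct H as [c Hc]. exists c. intros n. generalize (Hc n).
  replace (Nat.iter n _ 0) with (code_index (Const n)); [easy|].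
  induction n as [|n IH]; [reflexivity|].
  rewrite Nat.iter_succ, <- IH. reflexivity. }
unfold closure. cbn [code_index].
apply computable_affine, computable_pair; [computability|].
apply computable_affine, computable_pair; [exact Hc|computability].
Qed.

Definition Lam (t : code) : code := proj1_sig (computable_closure t).

Lemma eval_Lam t γ : eval (Lam t) γ (closure t γ).
Proof. apply (proj2_sig (computable_closure t)). Qed.

Lemma app_closure t γ x r : eval t ⟨γ, x⟩ r -> app (closure t γ) x r.
Proof.
intros H. exists (Comp t (Pair (Const γ) Id)). split; [reflexivity|].
exists ⟨γ, x⟩. split; [|exact H].
exists γ, x. auto using eval_Const, eval_Id.
Qed.

(** De Bruijn variables: contexts are left-nested pairs, innermost variable last. *)
Fixpoint Var (n : nat) : code :=
  match n with 0 => Snd | S m => Comp (Var m) Fst end.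

(** * The two stages of an element of [B] *)

Inductive stage := now | later.

Definition at_stage (a : B) (w : stage) : per :=
  match w with now => src a | later => tgt a end.

Definition stage_le (w w' : stage) : Prop :=
  match w, w' with later, now => False | _, _ => True end.

Lemma stage_le_refl w : stage_le w w.
Proof. now destruct w. Qed.

Lemma stage_le_later w : stage_le w later.
Proof. now destruct w. Qed.

Lemma at_stage_mono (a : B) w w' x y :
  stage_le w w' -> at_stage a w x y -> at_stage a w' x y.
Proof. destruct w, w'; cbn; try easy. intros _. apply (src_tgt (p := a)). Qed.

Lemma at_sym (a : B) w x y : at_stage a w x y -> at_stage a w y x.
Proof. pose proof (per_PER (at_stage a w)). intros H'. now symmetry. Qed.

Lemma at_trans (a : B) w x y z :
  at_stage a w x y -> at_stage a w y z -> at_stage a w x z.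
Proof. pose proof (per_PER (at_stage a w)). intros H1 H2. now transitivity y. Qed.

Lemma at_refl_l (a : B) w x y : at_stage a w x y -> at_stage a w x x.
Proof. intros H. exact (at_trans H (at_sym H)). Qed.

Lemma at_refl_r (a : B) w x y : at_stage a w x y -> at_stage a w y y.
Proof. intros H. exact (at_refl_l (at_sym H)). Qed.

Lemma le_B_iff (a b : B) :
  arr_le a b <-> forall w x y, at_stage a w x y -> at_stage b w x y.
Proof.
split; [intros [H K] []; [apply H|apply K]|].
intros H. split; [exact (H now)|exact (H later)].
Qed.

Lemma per_le_antisym (R S : per) : per_le R S -> per_le S R -> R = S.
Proof.
destruct R as [R HR], S as [S HS]. intros H K. cbn in *.
assert (R = S) as ->.
{ extensionality x. extensionality y. apply propositional_extensionality.
  split; [apply H|apply K]. }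
f_equal. apply proof_irrelevance.
Qed.

Lemma le_B_antisym (a b : B) : arr_le a b -> arr_le b a -> a = b.
Proof.
destruct a as [a0 a1 Ha], b as [b0 b1 Hb]. intros [H0 H1] [K0 K1]. cbn in *.
assert (a0 = b0) as -> by now apply per_le_antisym.
assert (a1 = b1) as -> by now apply per_le_antisym.
f_equal. apply proof_irrelevance.
Qed.

(** Kripke implication: the second component of [src (a ⇒ b)] is the condition at
    the later stage. *)
Lemma at_imp (a b : B) w x x' :
  at_stage (arr_imp a b) w x x' <->
  forall w', stage_le w w' -> forall y y', at_stage a w' y y' ->
    exists u u', app x y u /\ app x' y' u' /\ at_stage b w' u u'.
Proof.
destruct w; cbn; split.
- intros [H K] [] _; [exact H|exact K].
- intros H. split; [exact (H now I)|exact (H later I)].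
- intros H [] []. exact H.
- intros H. exact (H later I).
Qed.

Lemma at_inf (X : B -> Prop) w x y :
  at_stage (arr_inf X) w x y <-> forall a, X a -> at_stage a w x y.
Proof.
destruct w; cbn; split.
- intros H a Ha. apply H. now exists a.
- intros H R [a [Ha ->]]. exact (H a Ha).
- intros H a Ha. apply H. now exists a.
- intros H R [a [Ha ->]]. exact (H a Ha).
Qed.

Program Definition per_prod (R S : per) : per :=
  {| per_rel := fun x y => R (π₁ x) (π₁ y) /\ S (π₂ x) (π₂ y) |}.
Next Obligation.
intros R S. pose proof (per_PER R); pose proof (per_PER S). split.
- intros x y [H1 H2]. split; now symmetry.
- intros x y z [H1 H2] [K1 K2]. split; [now transitivity (π₁ y)|now transitivity (π₂ y)].
Qed.

Program Definition prod_B (a b : B) : B :=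
  {| src := per_prod (src a) (src b); tgt := per_prod (tgt a) (tgt b) |}.
Next Obligation.
intros a b x y [H K]. split; [now apply (src_tgt (p := a))|now apply (src_tgt (p := b))].
Qed.

Notation "a ⇒ b" := (@arr_imp B a b) (at level 55, right associativity).
Notation "a ⊗ b" := (prod_B a b) (at level 50, left associativity).
Notation "a ≼ b" := (@arr_le B a b) (at level 70).

Definition top_B : B := @arr_inf B (fun _ => False).

Lemma at_prod (a b : B) w x y :
  at_stage (a ⊗ b) w x y <->
  at_stage a w (π₁ x) (π₁ y) /\ at_stage b w (π₂ x) (π₂ y).
Proof. now destruct w. Qed.

Lemma at_pair (a b : B) w x x' y y' :
  at_stage a w x x' -> at_stage b w y y' -> at_stage (a ⊗ b) w ⟨x, y⟩ ⟨x', y'⟩.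
Proof. intros H K. rewrite at_prod, !cancel_of_to. now split. Qed.

Lemma le_top (a : B) : a ≼ top_B.
Proof. apply le_B_iff. intros w x y _. now apply at_inf. Qed.

Lemma inf_le (X : B -> Prop) a : X a -> arr_inf X ≼ a.
Proof. intros Ha. apply le_B_iff. intros w x y H. now apply (proj1 (at_inf X w x y) H). Qed.

(** * Typed realizability *)

(** [t] is a program over the context [Γ], compatible with the relations at both
    stages.  A context is an element of [B], the product of the types of its
    variables. *)
Definition realizes (Γ : B) (t : code) (a : B) : Prop :=
  forall w x x', at_stage Γ w x x' ->
    exists v v', eval t x v /\ eval t x' v' /\ at_stage a w v v'.

Notation "Γ ⊢ t ∈ a" := (realizes Γ t a) (at level 75, t at level 60, a at level 60).

Lemma realizes_le (Γ Δ a b : B) t : Δ ≼ Γ -> a ≼ b -> Γ ⊢ t ∈ a -> Δ ⊢ t ∈ b.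
Proof.
rewrite !le_B_iff. intros HΓ Hab H w x x' Hx.
destruct (H w x x' (HΓ _ _ _ Hx)) as [v [v' [Hv [Hv' Hvv]]]].
exists v, v'. auto.
Qed.

Lemma le_B_refl (a : B) : a ≼ a.
Proof. now apply le_B_iff. Qed.

Lemma realizes_sub (Γ a b : B) t : a ≼ b -> Γ ⊢ t ∈ a -> Γ ⊢ t ∈ b.
Proof. apply realizes_le, le_B_refl. Qed.

Lemma realizes_Id (a : B) : a ⊢ Id ∈ a.
Proof. intros w x x' H. exists x, x'. auto using eval_Id. Qed.

Lemma realizes_Comp (a b c : B) t u : a ⊢ t ∈ b -> b ⊢ u ∈ c -> a ⊢ Comp u t ∈ c.
Proof.
intros Ht Hu w x x' Hx.
destruct (Ht _ _ _ Hx) as [v [v' [Hv [Hv' Hvv]]]].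
destruct (Hu _ _ _ Hvv) as [r [r' [Hr [Hr' Hrr]]]].
exists r, r'. repeat split; [now exists v|now exists v'|exact Hrr].
Qed.

Lemma realizes_Fst (a b : B) : a ⊗ b ⊢ Fst ∈ a.
Proof.
intros w x x' [Hx _]%at_prod. now exists (π₁ x), (π₁ x').
Qed.

Lemma realizes_Snd (a b : B) : a ⊗ b ⊢ Snd ∈ b.
Proof.
intros w x x' [_ Hx]%at_prod. now exists (π₂ x), (π₂ x').
Qed.

Lemma realizes_Pair (Γ a b : B) t u : Γ ⊢ t ∈ a -> Γ ⊢ u ∈ b -> Γ ⊢ Pair t u ∈ a ⊗ b.
Proof.
intros Ht Hu w x x' Hx.
destruct (Ht _ _ _ Hx) as [v [v' [Hv [Hv' Hvv]]]].
destruct (Hu _ _ _ Hx) as [r [r' [Hr [Hr' Hrr]]]].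
exists ⟨v, r⟩, ⟨v', r'⟩. repeat split; [now exists v, r|now exists v', r'|].
now apply at_pair.
Qed.

Lemma realizes_Var_S (Γ a b : B) n : Γ ⊢ Var n ∈ a -> Γ ⊗ b ⊢ Var (S n) ∈ a.
Proof. apply realizes_Comp, realizes_Fst. Qed.

Lemma realizes_App (Γ a b : B) t u : Γ ⊢ t ∈ (a ⇒ b) -> Γ ⊢ u ∈ a -> Γ ⊢ App t u ∈ b.
Proof.
intros Ht Hu w x x' Hx.
destruct (Ht _ _ _ Hx) as [f [f' [Hf [Hf' Hff]]]].
destruct (Hu _ _ _ Hx) as [v [v' [Hv [Hv' Hvv]]]].
rewrite at_imp in Hff.
destruct (Hff w (stage_le_refl w) _ _ Hvv) as [r [r' [Hr [Hr' Hrr]]]].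
exists r, r'. repeat split; [eapply eval_App; eauto|eapply eval_App; eauto|exact Hrr].
Qed.

Lemma closure_imp (Γ a b : B) t w x x' :
  Γ ⊗ a ⊢ t ∈ b -> at_stage Γ w x x' ->
  at_stage (a ⇒ b) w (closure t x) (closure t x').
Proof.
intros Ht Hx. apply at_imp. intros w' Hw y y' Hy.
destruct (Ht w' _ _ (at_pair (at_stage_mono Hw Hx) Hy)) as [v [v' [Hv [Hv' Hvv]]]].
exists v, v'. auto using app_closure.
Qed.

(** An abstraction is defined whatever its body does, so this introduction rule for
    infima also covers the empty [X]; for other programs it would fail there.  This
    is where the restriction to the image of implication in the combinator [a] is
    used. *)
Lemma realizes_Lam_inf (Γ : B) (X : B -> Prop) t :
  (forall c, X c -> exists a b, c = (a ⇒ b) /\ Γ ⊗ a ⊢ t ∈ b) ->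
  Γ ⊢ Lam t ∈ arr_inf X.
Proof.
intros H w x x' Hx. exists (closure t x), (closure t x').
repeat split; try apply eval_Lam.
apply at_inf. intros c Hc. destruct (H c Hc) as [a [b [-> Ht]]].
exact (closure_imp Ht Hx).
Qed.

Lemma realizes_Lam (Γ a b : B) t : Γ ⊗ a ⊢ t ∈ b -> Γ ⊢ Lam t ∈ (a ⇒ b).
Proof.
intros Ht w x x' Hx. exists (closure t x), (closure t x').
repeat split; try apply eval_Lam. exact (closure_imp Ht Hx).
Qed.

Lemma realizes_Const (Γ a : B) n : at_stage a now n n -> Γ ⊢ Const n ∈ a.
Proof.
intros H w x x' _. exists n, n. repeat split; try apply eval_Const.
exact (at_stage_mono (w := now) I H).
Qed.

(** At stage [now] a program over the empty context is given by its value at 0, and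
    a value related to itself now is also related to itself later. *)
Lemma sep_iff (a : B) : arr_sep a <-> exists t, top_B ⊢ t ∈ a.
Proof.
split.
- intros [x [y H]]. exists (Const x). apply realizes_Const. exact (at_refl_l (w := now) H).
- intros [t Ht]. destruct (Ht now 0 0) as [v [v' [_ [_ H]]]]; [now apply at_inf|].
  now exists v, v'.
Qed.

(** * Nuclei *)

(** A nucleus on [B] presented by programs: [unit] and [bind] are the unit and the
    extension operation of a strong monad. *)
Record nucleus_terms (l : B -> B) (unit : code) (bind : code) : Prop := {
  nt_mono : forall a b : B, a ≼ b -> l a ≼ l b;
  nt_unit : forall a : B, a ⊢ unit ∈ l a;
  nt_bind : forall a b : B, (a ⇒ l b) ⊗ l a ⊢ bind ∈ l b }.

Ltac var := first [apply realizes_Snd | apply realizes_Var_S; var].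

Lemma nucleus_iff (l : B -> B) :
  is_nucleus l <-> exists unit bind, nucleus_terms l unit bind.
Proof.
split.
- intros [Hm [Hu Hb]]. apply sep_iff in Hu as [u Hu]. apply sep_iff in Hb as [b Hb].
  exists (App u Id), (App (App b Fst) Snd). split; [exact Hm| |].
  + intros a. eapply realizes_App; [|apply realizes_Id].
    refine (realizes_le (le_top _) _ Hu). apply inf_le. now exists a.
  + intros a c. eapply realizes_App; [|apply realizes_Snd].
    eapply realizes_App; [|apply realizes_Fst].
    refine (realizes_le (le_top _) _ Hb). apply inf_le. now exists a, c.
- intros [u [b [Hm Hu Hb]]]. split; [exact Hm|]. split; apply sep_iff.
  + exists (Lam (Comp u Snd)). apply realizes_Lam_inf. intros c [a ->].
    exists a, (l a). split; [reflexivity|].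
    eapply realizes_Comp; [apply realizes_Snd|apply Hu].
  + exists (Lam (Lam (Comp b (Pair (Var 1) (Var 0))))).
    apply realizes_Lam_inf. intros c [a [d ->]].
    exists (a ⇒ l d), (l a ⇒ l d). split; [reflexivity|].
    apply realizes_Lam. eapply realizes_Comp; [|apply Hb].
    apply realizes_Pair; var.
Qed.

(** [do t; u]: run [t], and continue with [u] with the result as a new variable. *)
Definition Bind (bind t u : code) : code := Comp bind (Pair (Lam u) t).

Section NucleusAlgebra.
Variables (l : B -> B) (unit bind : code).
Hypothesis Hl : nucleus_terms l unit bind.

Definition Ret (t : code) := Comp unit t.
Local Notation "'do' t ; u" := (Bind bind t u) (at level 60).

Lemma realizes_Ret (Γ a : B) t : Γ ⊢ t ∈ a -> Γ ⊢ Ret t ∈ l a.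
Proof. intros H. exact (realizes_Comp H (nt_unit Hl (a := a))). Qed.

Lemma realizes_Bind (Γ a b : B) t u :
  Γ ⊢ t ∈ l a -> Γ ⊗ a ⊢ u ∈ l b -> Γ ⊢ Bind bind t u ∈ l b.
Proof.
intros Ht Hu.
exact (realizes_Comp (realizes_Pair (realizes_Lam Hu) Ht) (nt_bind Hl (a := a) (b := b))).
Qed.

Ltac typing :=
  lazymatch goal with
  | |- _ ⊢ App _ _ ∈ _ => eapply realizes_App; [typing|typing]
  | |- _ ⊢ Var _ ∈ _ => var
  | |- _ ⊢ Lam _ ∈ _ => apply realizes_Lam; typing
  | |- _ ⊢ Pair _ _ ∈ _ => apply realizes_Pair; typing
  | |- _ ⊢ Ret _ ∈ _ => apply realizes_Ret; typing
  | |- _ ⊢ Bind _ _ _ ∈ _ => eapply realizes_Bind; [typing|typing]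
  | |- _ => idtac
  end.

(** Each combinator is realized by the usual λ-term, with [Ret] under every
    abstraction and [Bind] to use the result of an application, as implication in the
    algebra is [a ⇒ l b].  For the third combinator the term [λxy.xy] would not do: with an empty
    family [xy] need not be defined.  Its η-expansion [λxyz.xyz] has the right type
    because the members of the family are implications. *)
Lemma separator_nucleus : is_separator (A := nucleus_algebra l) (fun a => arr_sep (l a)).
Proof.
split; [|split; [|split; [|split]]].
- intros a b Ha Hab. apply sep_iff in Ha as [t Ht]. apply sep_iff.
  exists t. exact (realizes_sub (nt_mono Hl Hab) Ht).
- intros a b Hab Ha. apply sep_iff in Hab as [t Ht]. apply sep_iff in Ha as [u Hu].
  apply sep_iff. exists (do t; do Comp u Fst; App (Var 1) (Var 0)).
  eapply realizes_Bind; [exact Ht|].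
  eapply realizes_Bind; [exact (realizes_Comp (@realizes_Fst _ _) Hu)|typing].
- apply sep_iff. exists (Ret (Lam (Ret (Lam (Ret (Var 1)))))).
  apply realizes_Ret, realizes_Lam_inf. intros c [a [b ->]].
  eexists; eexists; split; [reflexivity|typing].
- apply sep_iff.
  exists (Ret (Lam (Ret (Lam (Ret (Lam
    (do App (Var 2) (Var 0); do App (Var 2) (Var 1); App (Var 1) (Var 0)))))))).
  apply realizes_Ret, realizes_Lam_inf. intros d [a [b [c ->]]].
  eexists; eexists; split; [reflexivity|typing].
- apply sep_iff.
  exists (Ret (Lam (Ret (Lam (Ret (Lam
    (do App (Var 2) (Var 1); App (Var 0) (Var 1)))))))).
  apply realizes_Ret, realizes_Lam_inf. intros e [a [X [HX ->]]].
  eexists; eexists; split; [reflexivity|].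
  apply realizes_Ret, realizes_Lam, realizes_Ret, realizes_Lam_inf.
  intros e He. destruct (HX e He) as [c [d ->]].
  eexists; eexists; split; [reflexivity|].
  eapply realizes_Bind; [|typing].
  eapply realizes_App; [|var].
  eapply realizes_sub; [|var].
  apply inf_le. eexists; split; [exact He|reflexivity].
Qed.

Lemma structure_nucleus : is_arrow_structure (nucleus_algebra l).
Proof.
split; [|split; [|split; [|split]]].
- exact le_B_refl.
- intros a b c. change (a ≼ b -> b ≼ c -> a ≼ c). rewrite !le_B_iff. auto.
- intros a b H K. exact (le_B_antisym H K).
- intros X a. change (a ≼ arr_inf X <-> forall x, X x -> a ≼ x). split.
  + intros H x Hx. rewrite le_B_iff in *. intros w y z Hy.
    exact (proj1 (at_inf X w y z) (H _ _ _ Hy) x Hx).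
  + intros H. apply le_B_iff. intros w y z Hy. apply at_inf.
    intros x Hx. exact (proj1 (le_B_iff a x) (H x Hx) _ _ _ Hy).
- intros a a' b b' Ha Hb. change (a' ≼ a) in Ha. change (b ≼ b') in Hb.
  change ((a ⇒ l b) ≼ (a' ⇒ l b')).
  apply (nt_mono Hl) in Hb. rewrite le_B_iff in *.
  intros w x x'. rewrite !at_imp. intros H w' Hw y y' Hy.
  destruct (H w' Hw y y' (Ha _ _ _ Hy)) as [u [u' [Hu [Hu' Huu]]]].
  exists u, u'. auto.
Qed.

Lemma nucleus_arrow_algebra : is_arrow_algebra (nucleus_algebra l).
Proof. split; [exact structure_nucleus|exact separator_nucleus]. Qed.

(** The [l] in the definition of the separator can be dropped, because [l] is already
    in front of the codomain of each implication. *)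
Lemma le_induced_iff (I : Type) (x y : induced (nucleus_algebra l) I) :
  ix_le x y <-> exists t, forall i, x i ⊢ t ∈ l (y i).
Proof.
split.
- intros H. apply sep_iff in H as [t Ht].
  exists (do t; App Snd Fst). intros i.
  refine (realizes_Bind (a := x i ⇒ l (y i)) _ _).
  + refine (realizes_le (le_top _) _ Ht). apply (nt_mono Hl), inf_le. now exists i.
  + exact (realizes_App (@realizes_Snd _ _) (@realizes_Fst _ _)).
- intros [t Ht]. apply sep_iff. exists (Ret (Lam (Comp t Snd))).
  apply realizes_Ret, realizes_Lam_inf. intros c [i ->].
  eexists; eexists; split; [reflexivity|].
  exact (realizes_Comp (@realizes_Snd _ _) (Ht i)).
Qed.

End NucleusAlgebra.

Lemma nucleus_terms_id : nucleus_terms (fun a => a) Id (App Fst Snd).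
Proof.
split; [easy|exact realizes_Id|].
intros a b. exact (realizes_App (@realizes_Fst _ _) (@realizes_Snd _ _)).
Qed.

Lemma at_j (a : B) w x x' :
  at_stage (nucleus_j a) w x x' <->
  (exists u u', x = S u /\ x' = S u' /\ at_stage a w u u') \/
  (w = later /\ x = 0 /\ x' = 0).
Proof.
destruct w; cbn; unfold sigma_star; split.
- now left.
- now intros [H|[H _]].
- intros [H|H]; [now left|now right].
- intros [H|[_ H]]; [now left|now right].
Qed.

Lemma at_k (a : B) w x x' :
  at_stage (nucleus_k a) w x x' <->
  at_stage a later x x' /\
  (w = now -> at_stage a now x x /\ at_stage a now x' x').
Proof.
destruct w; cbn; unfold restrict, dom; split.
- intros [H K]. auto.
- intros [H K]. auto.
- intros H. now split.
- now intros [H _].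
Qed.

(** [bind] sends the exceptional value 0 to 0 and [S u] to [f u].  Recursion would
    evaluate [f] at all the numbers below [u], where it may be undefined; so the case
    distinction is made first, on the arguments of a single application, with the
    index 0 of the program [Zero] in the exceptional case. *)
Lemma nucleus_terms_j : exists bind, nucleus_terms nucleus_j Succ bind.
Proof.
assert (H : computable (fun p => ncase (π₂ p) ⟨0, 0⟩ (fun u => ⟨π₁ p, u⟩)))
  by computability.
destruct H as [c Hc].
exists (Comp (proj1_sig universal) c).
assert (bind_O : forall f, eval (Comp (proj1_sig universal) c) ⟨f, 0⟩ 0).
{ intros f. exists ⟨0, 0⟩. split.
  - generalize (Hc ⟨f, 0⟩). now rewrite cancel_of_to.
  - apply (proj2_sig universal). now exists Zero. }
assert (bind_S : forall f u r, app f u r ->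
  eval (Comp (proj1_sig universal) c) ⟨f, S u⟩ r).
{ intros f u r H. exists ⟨f, u⟩. split.
  - generalize (Hc ⟨f, S u⟩). now rewrite cancel_of_to.
  - now apply (proj2_sig universal). }
split.
- intros a b. rewrite !le_B_iff. intros H w x y. rewrite !at_j.
  intros [[u [u' [-> [-> Hu]]]]|H']; [left|now right].
  exists u, u'. auto.
- intros a w x x' Hx. exists (S x), (S x'). repeat split.
  apply at_j. left. now exists x, x'.
- intros a b w x x' [Hf Hx]%at_prod.
  rewrite <- (pair_proj x), <- (pair_proj x').
  rewrite at_imp in Hf. apply at_j in Hx as [[u [u' [-> [-> Hu]]]]|[-> [-> ->]]].
  + destruct (Hf w (stage_le_refl w) u u' Hu) as [v [v' [Hv [Hv' Hvv]]]].
    exists v, v'. auto.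
  + exists 0, 0. repeat split; auto. apply at_j. now right.
Qed.

(** Both programs are trivial as [a ≼ k a] and [a ⇒ k b ≼ k a ⇒ k b].  For the
    latter, let [f] and [f'] be related now, and [y] and [y'] be related later and
    both self-related now.  Then [f y] and [f' y'] are related later by the condition
    at the later stage, and self-related now because [f] and [f'] are. *)
Lemma nucleus_terms_k : nucleus_terms nucleus_k Id (App Fst Snd).
Proof.
split.
- intros a b. rewrite !le_B_iff. intros H w x y. rewrite !at_k.
  intros [Hx Hw]. split; [now apply H|]. intros E. destruct (Hw E). auto.
- intros a. apply (realizes_sub (a := a)); [|apply realizes_Id].
  apply le_B_iff. intros w x y H. apply at_k. split.
  + exact (at_stage_mono (stage_le_later w) H).
  + intros ->. exact (conj (at_refl_l H) (at_refl_r H)).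
- intros a b.
  apply (realizes_le (Γ := (nucleus_k a ⇒ nucleus_k b) ⊗ nucleus_k a)
    (a := nucleus_k b)); [|apply le_B_refl|].
  2: exact (realizes_App (@realizes_Fst _ _) (@realizes_Snd _ _)).
  apply le_B_iff. intros w p p'. rewrite !at_prod. intros [Hf Hx]. split; [|exact Hx].
  revert Hf. generalize (π₁ p) (π₁ p'). clear p p' Hx. intros f f' Hf.
  apply at_imp. intros w' Hw y y' [Hy Hn]%at_k.
  apply (at_stage_mono Hw) in Hf. clear w Hw.
  assert (Hl : at_stage (a ⇒ nucleus_k b) later f f')
    by exact (at_stage_mono (stage_le_later w') Hf).
  rewrite at_imp in Hl. destruct (Hl later I y y' Hy) as [u [u' [Hu [Hu' Huu]]]].
  exists u, u'. repeat split; auto. apply at_k. split; [now apply at_k in Huu|].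
  intros ->. destruct (Hn eq_refl) as [Hyy Hyy'].
  split.
  + apply at_refl_l in Hf. rewrite at_imp in Hf.
    destruct (Hf now I y y Hyy) as [v [v' [Hv [Hv' Hvv]]]].
    apply at_k in Hvv as [_ Hvv]. rewrite (app_functional Hu Hv).
    now apply Hvv.
  + apply at_refl_r in Hf. rewrite at_imp in Hf.
    destruct (Hf now I y' y' Hyy') as [v [v' [Hv [Hv' Hvv]]]].
    apply at_k in Hvv as [_ Hvv]. rewrite (app_functional Hu' Hv).
    now apply Hvv.
Qed.

(** Composition of monads along a distributive law.  Given [f : a ⇒ j (k b)] and
    [x : k a], the inner [Bind] for [k] gives an element of [k (j (k b))], which is
    below [j (k (k b))]; the rest collapses [k (k b)] to [k b]. *)
Lemma nucleus_terms_comp (j k : B -> B) uj bj uk bk :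
  nucleus_terms j uj bj -> nucleus_terms k uk bk ->
  (forall a, k (j a) ≼ j (k a)) ->
  exists bind, nucleus_terms (fun a => j (k a)) (Comp uj uk) bind.
Proof.
intros Hj Hk Hkj.
exists (Bind bj Snd (Bind bj
  (Bind bk (Var 0) (Ret uk (App (Comp Fst (Comp Fst Fst)) (Var 0))))
  (Ret uj (Bind bk (Var 0) (Var 0))))).
split.
- intros a b H. apply (nt_mono Hj), (nt_mono Hk), H.
- intros a. exact (realizes_Comp (nt_unit Hk (a := a)) (nt_unit Hj (a := k a))).
- intros a b.
  apply (realizes_Bind Hj (a := k a)); [apply realizes_Snd|].
  apply (realizes_Bind Hj (a := k (k b))).
  + apply (realizes_sub (Hkj _)).
    apply (realizes_Bind Hk (a := a)); [var|].
    apply (realizes_Ret Hk). apply (realizes_App (a := a)); [|var].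
    refine (realizes_Comp (realizes_Comp _ _) _); apply realizes_Fst.
  + apply (realizes_Ret Hj), (realizes_Bind Hk (a := k b)); var.
Qed.

(** The distributive law holds as an inclusion: a value of [j a] that is
    self-related now is not the exceptional one. *)
Lemma nucleus_terms_jk : exists bind, nucleus_terms nucleus_jk (Comp Succ Id) bind.
Proof.
destruct nucleus_terms_j as [bj Hj].
apply (nucleus_terms_comp Hj nucleus_terms_k).
intros a. apply le_B_iff. intros w x y. rewrite at_k, !at_j.
intros [[[u [u' [-> [-> Hu]]]]|[_ [-> ->]]] Hw].
- left. exists u, u'. repeat split. apply at_k. split; [exact Hu|].
  intros E. destruct (Hw E) as [H H'].
  destruct H as [[v [v' [Ev [_ H]]]]|[Ev _]]; [|discriminate].
  destruct H' as [[v1 [v1' [Ev1 [Ev1' H']]]]|[Ev1 _]]; [|discriminate].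
  injection Ev as <-. injection Ev1 as <-. injection Ev1' as <-.
  split; [exact (at_refl_l H)|exact H'].
- destruct w; [|now right].
  destruct (Hw eq_refl) as [H _].
  now destruct H as [[v [v' [Ev _]]]|[Ev _]].
Qed.

(** * Triposes from universal implication *)

Definition pointwise (Φ : Type) (le : forall I, (I -> Φ) -> (I -> Φ) -> Prop) :
    indexedRel :=
  {| ix_car := fun I => I -> Φ;
     ix_le := le;
     ix_map := fun I J f x i => x (f i) |}.

(** The rules for [imp y X] over a family [X i] of subsets of [Φ].  In [ui_curry] the
    family is enumerated by [k : K -> I] and [b : K -> Φ]: the members of [X i] are
    among the [b κ] with [k κ = i].  With [k] the identity this is the
    deduction rule for implication, and with [y] the top element the rule for [∀]
    along [k]. *)
Record universal_implication (Φ : Type) (le : forall I, (I -> Φ) -> (I -> Φ) -> Prop)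
    (top : Φ) (meet : Φ -> Φ -> Φ) (imp : Φ -> (Φ -> Prop) -> Φ) : Prop := {
  ui_refl : forall I (x : I -> Φ), le I x x;
  ui_trans : forall I (x y z : I -> Φ), le I x y -> le I y z -> le I x z;
  ui_reindex : forall I J (f : I -> J) (x y : J -> Φ),
    le J x y -> le I (fun i => x (f i)) (fun i => y (f i));
  ui_top : forall I (x : I -> Φ), le I x (fun _ => top);
  ui_meet : forall I (x y z : I -> Φ),
    le I z (fun i => meet (x i) (y i)) <-> le I z x /\ le I z y;
  ui_eval : forall I (y b : I -> Φ) (X : I -> Φ -> Prop),
    (forall i, X i (b i)) -> le I (fun i => meet (imp (y i) (X i)) (y i)) b;
  ui_curry : forall I K (k : K -> I) (x y : I -> Φ) (b : K -> Φ) (X : I -> Φ -> Prop),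
    (forall i φ, X i φ -> exists κ, k κ = i /\ b κ = φ) ->
    le K (fun κ => meet (x (k κ)) (y (k κ))) b ->
    le I x (fun i => imp (y i) (X i)) }.

(** Transport along a map [F] that preserves and reflects the order and has a section
    [G] up to isomorphism. *)
Lemma universal_implication_transport Φ Ψ
    (le : forall I, (I -> Φ) -> (I -> Φ) -> Prop)
    (le' : forall I, (I -> Ψ) -> (I -> Ψ) -> Prop) top meet imp
    (F : Ψ -> Φ) (G : Φ -> Ψ) :
  universal_implication le top meet imp ->
  (forall I (x y : I -> Ψ), le' I x y <-> le I (fun i => F (x i)) (fun i => F (y i))) ->
  (forall I (x : I -> Φ), le I (fun i => F (G (x i))) x) ->
  (forall I (x : I -> Φ), le I x (fun i => F (G (x i)))) ->
  universal_implication le' (G top) (fun x y => G (meet (F x) (F y)))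
    (fun x X => G (imp (F x) (fun φ => exists a, X a /\ φ = F a))).
Proof.
intros H HF FG GF. split; intros *; rewrite ?HF.
- apply (ui_refl H).
- apply (ui_trans H).
- apply (ui_reindex H (fun i => f i) (x := fun i => F (x i)) (y := fun i => F (y i))).
- exact (ui_trans H (ui_top H _) (GF _ _)).
- rewrite <- (ui_meet H). split; intros K; exact (ui_trans H K ltac:(first [apply FG|apply GF])).
- intros HX. eapply (ui_trans H); [apply FG|].
  refine (ui_trans H _ (ui_eval H (fun i => F (y i)) (b := fun i => F (b i))
    (X := fun i φ => exists a, X i a /\ φ = F a) _)).
  + apply (ui_meet H). pose proof (proj1 (ui_meet H
      (fun i => F (G (imp (F (y i)) (fun φ => exists a, X i a /\ φ = F a))))
      (fun i => F (y i)) _) (ui_refl H _)) as [H1 H2].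
    split; [exact (ui_trans H H1 (FG _ _))|exact H2].
  + intros i. now exists (b i).
- intros HX Hle. refine (ui_trans H _ (GF _ _)).
  apply (ui_curry H (k := k) (b := fun κ => F (b κ))).
  + intros i φ [a [Ha ->]]. destruct (HX i a Ha) as [κ [<- <-]]. now exists κ.
  + refine (ui_trans H (GF _ _) Hle).
Qed.

Section Tripos.
Variables (Φ : Type) (le : forall I, (I -> Φ) -> (I -> Φ) -> Prop).
Variables (top : Φ) (meet : Φ -> Φ -> Φ) (imp : Φ -> (Φ -> Prop) -> Φ).
Hypothesis H : universal_implication le top meet imp.

Local Notation "x ≤ y" := (le x y) (at level 70).

Definition imp1 (a b : Φ) : Φ := imp a (eq b).
Definition all (X : Φ -> Prop) : Φ := imp top X.
(** [∃ a ∈ X, a] as [∀ c, (∀ a ∈ X, a ⇒ c) ⇒ c]. *)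
Definition some (X : Φ -> Prop) : Φ :=
  all (fun φ => exists c, φ = imp1 (all (fun ψ => exists a, X a /\ ψ = imp1 a c)) c).
(** Not [some] of the set of [a] and [b]: to eliminate that, one realizer would have
    to serve for both cases. *)
Definition join (a b : Φ) : Φ :=
  all (fun φ => exists c, φ = imp1 (imp1 a c) (imp1 (imp1 b c) c)).
Definition bot : Φ := all (fun _ => True).

Let refl := ui_refl H.
Let trans := ui_trans H.

Lemma meet_le_l I (x y : I -> Φ) : (fun i => meet (x i) (y i)) ≤ x.
Proof. exact (proj1 (proj1 (ui_meet H x y _) (refl _))). Qed.

Lemma meet_le_r I (x y : I -> Φ) : (fun i => meet (x i) (y i)) ≤ y.
Proof. exact (proj2 (proj1 (ui_meet H x y _) (refl _))). Qed.

Lemma le_meet I (x y z : I -> Φ) : z ≤ x -> z ≤ y -> z ≤ (fun i => meet (x i) (y i)).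
Proof. intros Hx Hy. now apply (ui_meet H). Qed.

Lemma imp1_elim I (x y z : I -> Φ) : z ≤ (fun i => imp1 (x i) (y i)) -> z ≤ x -> z ≤ y.
Proof.
intros Hi Hx.
refine (trans (le_meet Hi Hx) (ui_eval H x (b := y) (X := fun i => eq (y i)) _)). easy.
Qed.

Lemma imp1_intro I (x y z : I -> Φ) :
  (fun i => meet (z i) (x i)) ≤ y -> z ≤ (fun i => imp1 (x i) (y i)).
Proof.
apply (ui_curry H (k := fun i : I => i)). intros i φ <-. now exists i.
Qed.

Lemma all_elim I (b z : I -> Φ) (X : I -> Φ -> Prop) :
  (forall i, X i (b i)) -> z ≤ (fun i => all (X i)) -> z ≤ b.
Proof.
intros HX Hz.
exact (trans (le_meet Hz (ui_top H _)) (ui_eval H (fun _ => top) HX)).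
Qed.

Lemma all_intro I K (k : K -> I) (x : I -> Φ) (b : K -> Φ) (X : I -> Φ -> Prop) :
  (forall i φ, X i φ -> exists κ, k κ = i /\ b κ = φ) ->
  (fun κ => x (k κ)) ≤ b -> x ≤ (fun i => all (X i)).
Proof.
intros HX Hb. apply (ui_curry H HX). exact (trans (meet_le_l _ _) Hb).
Qed.

(** The quantification over [c] in [some] is enumerated by [I * Φ] over [I]. *)
Lemma some_intro I (x : I -> Φ) (X : I -> Φ -> Prop) :
  (forall i, X i (x i)) -> x ≤ (fun i => some (X i)).
Proof.
intros HX.
apply (all_intro (k := @fst I Φ)
  (b := fun p => imp1 (all (fun ψ => exists a, X (fst p) a /\ ψ = imp1 a (snd p))) (snd p))).
- intros i φ [c ->]. now exists (i, c).
- apply imp1_intro.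
  apply (imp1_elim (x := fun p => x (fst p))); [|apply meet_le_l].
  eapply all_elim; [|apply meet_le_r]. intros p. now exists (x (fst p)).
Qed.

(** The case [c = y i] of the quantification over [c]. *)
Lemma some_elim I K (k : K -> I) (y : I -> Φ) (b : K -> Φ) (X : I -> Φ -> Prop) :
  (forall i φ, X i φ -> exists κ, k κ = i /\ b κ = φ) ->
  b ≤ (fun κ => y (k κ)) -> (fun i => some (X i)) ≤ y.
Proof.
intros HX Hb.
apply (imp1_elim (x := fun i => all (fun ψ => exists a, X i a /\ ψ = imp1 a (y i)))).
- eapply all_elim; [|apply refl]. intros i. now exists (y i).
- apply (all_intro (k := k) (b := fun κ => imp1 (b κ) (y (k κ)))).
  + intros i φ [a [Ha ->]]. destruct (HX i a Ha) as [κ [<- <-]]. now exists κ.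
  + apply imp1_intro. exact (trans (meet_le_r _ _) Hb).
Qed.

Lemma bot_least I (x : I -> Φ) : (fun _ => bot) ≤ x.
Proof. eapply all_elim; [|apply refl]. easy. Qed.

Lemma join_l I (x y : I -> Φ) : x ≤ (fun i => join (x i) (y i)).
Proof.
apply (all_intro (k := @fst I Φ) (b := fun p =>
  imp1 (imp1 (x (fst p)) (snd p)) (imp1 (imp1 (y (fst p)) (snd p)) (snd p)))).
- intros i φ [c ->]. now exists (i, c).
- do 2 apply imp1_intro.
  eapply imp1_elim; [eapply trans; [apply meet_le_l|apply meet_le_r]|].
  eapply trans; [apply meet_le_l|apply meet_le_l].
Qed.

Lemma join_r I (x y : I -> Φ) : y ≤ (fun i => join (x i) (y i)).
Proof.
apply (all_intro (k := @fst I Φ) (b := fun p =>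
  imp1 (imp1 (x (fst p)) (snd p)) (imp1 (imp1 (y (fst p)) (snd p)) (snd p)))).
- intros i φ [c ->]. now exists (i, c).
- do 2 apply imp1_intro.
  eapply imp1_elim; [apply meet_le_r|].
  eapply trans; [apply meet_le_l|apply meet_le_l].
Qed.

Lemma join_least I (x y z : I -> Φ) :
  x ≤ z -> y ≤ z -> (fun i => join (x i) (y i)) ≤ z.
Proof.
intros Hx Hy.
assert (Hi : forall u w : I -> Φ, u ≤ z -> w ≤ (fun i => imp1 (u i) (z i))).
{ intros u w Hu. apply imp1_intro. exact (trans (meet_le_r _ _) Hu). }
apply (imp1_elim (x := fun i => imp1 (y i) (z i))); [|now apply Hi].
apply (imp1_elim (x := fun i => imp1 (x i) (z i))); [|now apply Hi].
eapply all_elim; [|apply refl]. intros i. now exists (z i).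
Qed.

Local Notation P := (pointwise le).

Lemma pointwise_preorder : is_indexed_preorder P.
Proof.
split; [exact refl|]. split; [exact trans|]. split; [exact (ui_reindex H)|].
split; intros; (split; apply refl).
Qed.

Lemma is_top_top I : is_top (@le I) (fun _ => top).
Proof. exact (@ui_top _ _ _ _ _ H I). Qed.

Lemma is_meet_meet I (x y : I -> Φ) : is_meet (@le I) x y (fun i => meet (x i) (y i)).
Proof. intros z. apply (ui_meet H). Qed.

Lemma is_join_join I (x y : I -> Φ) : is_join (@le I) x y (fun i => join (x i) (y i)).
Proof.
intros z. split.
- intros K. split; eapply trans; try exact K; [apply join_l|apply join_r].
- intros [K L]. now apply join_least.
Qed.

Lemma is_impl_imp1 I (x y : I -> Φ) : is_impl (@le I) x y (fun i => imp1 (x i) (y i)).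
Proof.
intros z m Hm. destruct (proj1 (Hm m) (refl m)) as [Hz Hx]. split.
- intros K. exact (imp1_elim (trans Hz K) Hx).
- intros K. apply imp1_intro. refine (trans _ K). apply Hm.
  split; [apply meet_le_l|apply meet_le_r].
Qed.

Lemma pointwise_preHeyt I : is_preHeyt (@le I).
Proof.
split; [exact (@refl I)|]. split; [exact (@trans I)|].
split; [eexists; apply is_top_top|].
split; [exists (fun _ => bot); exact (@bot_least I)|].
split; [intros; eexists; apply is_meet_meet|].
split; intros; eexists; [apply is_join_join|apply is_impl_imp1].
Qed.

(** Universal elements are unique up to isomorphism and the chosen ones are
    computed pointwise, so any universal element is compared with the chosen one and
    the comparison is reindexed. *)
Lemma reindex_preHeyt I J (f : I -> J) :
  is_preHeyt_morphism (@le J) (@le I) (ix_map P f).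
Proof.
pose proof (ui_reindex H f) as Hf.
split; [exact Hf|]. split; [|split; [|split; [|split]]].
- intros t Ht z. refine (trans (ui_top H z) _). exact (Hf _ _ (Ht (fun _ => top))).
- intros b Hb z. refine (trans _ (bot_least z)). exact (Hf _ _ (Hb (fun _ => bot))).
- intros x y m Hm z. destruct (proj1 (Hm m) (refl m)) as [Hx Hy]. split.
  + intros K. exact (conj (trans K (Hf _ _ Hx)) (trans K (Hf _ _ Hy))).
  + intros [K L]. refine (trans (le_meet K L) _).
    exact (Hf _ _ (proj2 (Hm _) (proj1 (is_meet_meet x y _) (refl _)))).
- intros x y u Hu z. destruct (proj1 (Hu u) (refl u)) as [Hx Hy]. split.
  + intros K. exact (conj (trans (Hf _ _ Hx) K) (trans (Hf _ _ Hy) K)).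
  + intros [K L]. refine (trans _ (join_least K L)).
    exact (Hf _ _ (proj2 (Hu _) (proj1 (is_join_join x y _) (refl _)))).
- intros x y h Hh z m Hm. destruct (proj1 (Hm m) (refl m)) as [Hz Hx].
  assert (Hhi : h ≤ (fun j => imp1 (x j) (y j))).
  { apply imp1_intro. now apply (Hh h _ (is_meet_meet h x)). }
  assert (Hih : (fun j => imp1 (x j) (y j)) ≤ h).
  { apply (Hh _ _ (is_meet_meet _ x)).
    exact (imp1_elim (meet_le_l _ _) (meet_le_r _ _)). }
  rewrite <- (is_impl_imp1 (ix_map P f y) Hm).
  split; intros K; [exact (trans K (Hf _ _ Hhi))|exact (trans K (Hf _ _ Hih))].
Qed.

Definition exists_along I J (f : I -> J) (x : I -> Φ) (j : J) : Φ :=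
  some (fun φ => exists i, f i = j /\ x i = φ).

Definition forall_along I J (f : I -> J) (x : I -> Φ) (j : J) : Φ :=
  all (fun φ => exists i, f i = j /\ x i = φ).

Lemma exists_along_adjoint I J (f : I -> J) (x : I -> Φ) (y : J -> Φ) :
  exists_along f x ≤ y <-> x ≤ (fun i => y (f i)).
Proof.
split.
- intros K. refine (trans _ (ui_reindex H f K)).
  apply some_intro. intros i. now exists i.
- apply some_elim. easy.
Qed.

Lemma forall_along_adjoint I J (f : I -> J) (x : I -> Φ) (y : J -> Φ) :
  (fun i => y (f i)) ≤ x <-> y ≤ forall_along f x.
Proof.
split.
- apply all_intro. easy.
- intros K. apply (all_elim (X := fun i φ => exists i', f i' = f i /\ x i' = φ)).
  + intros i. now exists i.
  + exact (ui_reindex H f K).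
Qed.

Lemma adjoint_intro I J (l : (I -> Φ) -> (J -> Φ)) (r : (J -> Φ) -> (I -> Φ)) :
  (forall x y, l x ≤ y <-> x ≤ r y) -> adjoint (@le I) (@le J) l r.
Proof.
intros A. split; [|split; [|exact A]].
- intros x y K. apply A. refine (trans K _). now apply A.
- intros x y K. apply A. refine (trans _ K). now apply A.
Qed.

(** The set quantified over at [g k] is the same on both sides, by surjectivity of
    [L] onto the fibre product. *)
Lemma forall_along_base_change I J K L (f : I -> J) (g : K -> J) (p : L -> I) (q : L -> K)
    (x : I -> Φ) :
  (forall i k, f i = g k -> exists l, p l = i /\ q l = k) ->
  forall_along q (fun l => x (p l)) ≤ (fun k => forall_along f x (g k)).
Proof.
intros Hpb. apply (all_intro (k := q) (b := fun l => x (p l))).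
- intros k φ [i [Hi <-]]. destruct (Hpb i k Hi) as [l [<- <-]]. now exists l.
- apply forall_along_adjoint, refl.
Qed.

(** In each Beck-Chevalley isomorphism one inequality is formal.  The other one is
    [forall_along_base_change] for [∀]; for [∃] it is obtained from the same lemma for
    the transposed square, as [g^* ∃_f x ≤ y] iff [x ≤ f^* ∀_g y], and
    [∀_p q^* y ≤ f^* ∀_g y]. *)
Lemma pointwise_tripos : is_tripos P.
Proof.
split; [exact pointwise_preorder|]. split; [exact pointwise_preHeyt|].
split; [exact reindex_preHeyt|]. split; [|split].
- intros I J f. split.
  + exists (exists_along f). apply adjoint_intro, exists_along_adjoint.
  + exists (forall_along f). apply (adjoint_intro (l := ix_map P f)).
    intros x y. exact (forall_along_adjoint f y x).
- intros I J K L f g p q Hpb.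
  assert (E : forall z : J -> Φ, (fun l => z (f (p l))) = (fun l => z (g (q l)))).
  { intros z. extensionality l. now rewrite (proj1 Hpb). }
  assert (Hex : forall i k, f i = g k -> exists l, p l = i /\ q l = k).
  { intros i k Hik. destruct (proj2 Hpb i k Hik) as [l [Hl _]]. now exists l. }
  split.
  + intros Ef Eq [_ [_ Af]] [_ [_ Aq]] x. split; cbn in *.
    * apply Aq. rewrite <- E. apply (ui_reindex H p (y := fun i => Ef x (f i))), Af, refl.
    * set (y := Eq (fun l => x (p l))).
      refine (trans (ui_reindex H g (y := forall_along g y) _) _).
      -- apply Af.
         refine (@trans _ _ (forall_along p (fun l => y (q l))) _ _ _).
         ++ apply (forall_along_adjoint p (fun l => y (q l)) x), Aq, refl.
         ++ apply forall_along_base_change. intros k i Hki.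
            destruct (Hex i k (eq_sym Hki)) as [l [<- <-]]. now exists l.
      -- apply (forall_along_adjoint g y), refl.
  + intros Af Aq [_ [_ HAf]] [_ [_ HAq]] x. split; cbn in *.
    * refine (@trans _ _ (forall_along q (fun l => x (p l))) _ _ _).
      { apply (forall_along_adjoint q (fun l => x (p l)) _), HAq, refl. }
      refine (trans (forall_along_base_change x Hex) _).
      apply (ui_reindex H g (x := forall_along f x)), HAf, (forall_along_adjoint f x _), refl.
    * apply HAq. rewrite <- E. apply (ui_reindex H p (x := fun i => Af x (f i))), HAf, refl.
- exists Φ, (fun φ => φ). intros I x. exists x. split; apply refl.
Qed.

End Tripos.

(** * The tripos of a nucleus on [B] *)

Definition uimp_B (l : B -> B) (a : B) (X : B -> Prop) : B :=
  @arr_inf B (fun c => exists b, X b /\ c = (a ⇒ l b)).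

(** Again λ-terms in monadic style; [Lam] is introduced for all members of [X] at once
    by [realizes_Lam_inf]. *)
Lemma nucleus_universal_implication (l : B -> B) unit bind :
  nucleus_terms l unit bind ->
  universal_implication (fun I => @ix_le (induced (nucleus_algebra l)) I)
    top_B prod_B (uimp_B l).
Proof.
intros Hl.
assert (L : forall I (x y : I -> B), ix_le (i := induced (nucleus_algebra l)) x y <->
   exists t, forall i, x i ⊢ t ∈ l (y i)) by (intros; apply (le_induced_iff Hl)).
split; intros *; rewrite ?L.
- exists unit. intros i. apply (nt_unit Hl).
- intros [t Ht] [u Hu]. exists (Bind bind t (Comp u Snd)). intros i.
  exact (realizes_Bind Hl (Ht i) (realizes_Comp (@realizes_Snd _ _) (Hu i))).
- intros [t Ht]. exists t. intros i. apply Ht.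
- exists unit. intros i. exact (realizes_le (le_top _) (le_B_refl _) (nt_unit Hl (a := top_B))).
- split.
  + intros [t Ht]. split.
    * exists (Bind bind t (Ret unit (Comp Fst Snd))). intros i.
      refine (realizes_Bind Hl (Ht i) (realizes_Ret Hl _)).
      exact (realizes_Comp (@realizes_Snd _ _) (@realizes_Fst _ _)).
    * exists (Bind bind t (Ret unit (Comp Snd Snd))). intros i.
      refine (realizes_Bind Hl (Ht i) (realizes_Ret Hl _)).
      exact (realizes_Comp (@realizes_Snd _ _) (@realizes_Snd _ _)).
  + intros [[t Ht] [u Hu]].
    exists (Bind bind t (Bind bind (Comp u Fst) (Ret unit (Pair (Var 1) (Var 0))))).
    intros i. apply (realizes_Bind Hl (Ht i)).
    apply (realizes_Bind Hl (realizes_Comp (@realizes_Fst _ _) (Hu i))).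
    apply (realizes_Ret Hl), realizes_Pair; var.
- intros HX. exists (App Fst Snd). intros i.
  refine (realizes_App (a := y i) _ (@realizes_Snd _ _)).
  refine (realizes_sub _ (@realizes_Fst _ _)).
  apply inf_le. now exists (b i).
- intros HX [t Ht]. exists (Ret unit (Lam t)). intros i.
  apply (realizes_Ret Hl), realizes_Lam_inf. intros c [φ [Hφ ->]].
  destruct (HX i φ Hφ) as [κ [<- <-]].
  exists (y (k κ)), (l (b κ)). split; [reflexivity|apply Ht].
Qed.

(** * Comparison with [V] *)

Program Definition sv_per (α : Sigma_V) : per := {| per_rel := sv_rel α |}.
Next Obligation.
intros α. split; [exact (@sv_sym α)|exact (@sv_trans α)].
Qed.

Program Definition B_of_V (α : Sigma_V) : B :=
  {| src := per_restrict (sv_per α) (sv0 α); tgt := sv_per α |}.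
Next Obligation. now intros α x y [H _]. Qed.

(** The value on [j k a] of the inverse of [B_of_V]: by [k] the relation now is the
    restriction of the relation later to a subset, and by [j] the number 0 is
    self-related later. *)
Program Definition V_of_B (a : B) : Sigma_V :=
  {| sv0 := fun x => at_stage (nucleus_jk a) now x x;
     sv1 := fun x => at_stage (nucleus_jk a) later x x;
     sv_rel := at_stage (nucleus_jk a) later |}.
Next Obligation. intros a n. exact (@at_stage_mono (nucleus_jk a) now later n n I). Qed.
Next Obligation. intros a. apply at_j. now right. Qed.
Next Obligation. intros a n m H. exact (conj (at_refl_l H) (at_refl_r H)). Qed.
Next Obligation. easy. Qed.
Next Obligation. intros a n m. apply at_sym. Qed.
Next Obligation. intros a n m p. apply at_trans. Qed.

Definition le_B_jk I := @ix_le (induced B_jk) I.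

Lemma le_B_jk_iff I (x y : I -> B) :
  le_B_jk x y <-> exists t, forall i, x i ⊢ t ∈ nucleus_jk (y i).
Proof.
destruct nucleus_terms_jk as [b Hb]. exact (le_induced_iff Hb x y).
Qed.

Lemma predecessor : {c | forall n, eval c n (pred n)}.
Proof.
assert (H : computable (fun x => ncase x 0 (fun n => n))) by computability.
destruct H as [c Hc]. exists c. intros n. generalize (Hc n). now destruct n.
Qed.

Lemma at_jk (a : B) w x x' :
  at_stage (nucleus_jk a) w x x' <->
  (exists u u', x = S u /\ x' = S u' /\ at_stage a later u u' /\
     (w = now -> at_stage a now u u /\ at_stage a now u' u')) \/
  (w = later /\ x = 0 /\ x' = 0).
Proof.
unfold nucleus_jk. rewrite at_j. split.
- intros [[u [u' [Hx [Hx' Hu%at_k]]]]|Hw]; [left; now exists u, u'|now right].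
- intros [[u [u' [Hx [Hx' Hu]]]]|Hw]; [left; exists u, u'|now right].
  split; [exact Hx|split; [exact Hx'|now apply at_k]].
Qed.

(** A tracker [r] gives the program [x ↦ S (r x)].  Conversely the predecessor of a
    value in [j k] is a value of the intended kind: the exceptional value 0 only
    occurs later, where it goes to the element [sv_zero]. *)
Lemma B_of_V_full I (α β : I -> Sigma_V) :
  V_le α β <-> le_B_jk (fun i => B_of_V (α i)) (fun i => B_of_V (β i)).
Proof.
rewrite le_B_jk_iff. split.
- intros [r Hr]. destruct (code_index_surj r) as [c <-].
  exists (Comp Succ c). intros i. destruct (Hr i) as [H1 [H2 H3]].
  assert (ev : forall n v, app (code_index c) n v -> eval (Comp Succ c) n (S v)).
  { intros n v [d [E Hd]]. apply code_index_inj in E as ->. now exists v. }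
  assert (Hrel : forall x x', sv_rel (α i) x x' -> exists v v',
    app (code_index c) x v /\ app (code_index c) x' v' /\ sv_rel (β i) v v').
  { intros x x' Hx. destruct (sv_field Hx). now apply H2. }
  intros w x x' Hx.
  assert (Hrel' : sv_rel (α i) x x') by (destruct w; [apply Hx|exact Hx]).
  destruct (Hrel x x' Hrel') as [v [v' [Hv [Hv' Hvv]]]].
  exists (S v), (S v'). split; [auto|split; [auto|]].
  apply at_jk. left. exists v, v'. do 3 (split; [easy|]). intros ->.
  destruct Hx as [_ [Hx Hx']].
  assert (H0 : forall n m, sv0 (α i) n -> app (code_index c) n m ->
    at_stage (B_of_V (β i)) now m m).
  { intros n m Hn Hm. destruct (H3 n Hn) as [m' [Hm' Hm0]].
    rewrite (app_functional Hm Hm'). split; [|now split].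
    apply sv_refl, sv_sub, Hm0. }
  split; [now apply (H0 x)|now apply (H0 x')].
- intros [t Ht]. destruct predecessor as [p Hp].
  exists (code_index (Comp p t)). intros i.
  assert (Hw : forall w x x', at_stage (B_of_V (α i)) w x x' -> exists v v',
    app (code_index (Comp p t)) x v /\ app (code_index (Comp p t)) x' v' /\
    sv_rel (β i) v v' /\ (w = now -> sv0 (β i) v)).
  { intros w x x' Hx. destruct (Ht i w x x' Hx) as [y [y' [Hy [Hy' Hyy]]]].
    assert (ev : forall n m, eval t n m -> app (code_index (Comp p t)) n (pred m)).
    { intros n m Hm. exists (Comp p t). split; [reflexivity|]. now exists m. }
    exists (pred y), (pred y'). split; [auto|split; [auto|]].
    apply at_jk in Hyy as [[u [u' [-> [-> [Hu Hn]]]]]|[-> [-> ->]]].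
    - split; [exact Hu|]. intros E. apply (Hn E).
    - split; [apply sv_refl, sv_zero|easy]. }
  split; [|split].
  + intros n Hn. destruct (Hw later n n (sv_refl Hn)) as [v [v' [Hv [_ [Hvv _]]]]].
    exists v. split; [exact Hv|apply (sv_field Hvv)].
  + intros n m _ _ Hnm. destruct (Hw later n m Hnm) as [v [v' [Hv [Hv' [Hvv _]]]]].
    now exists v, v'.
  + intros n Hn. destruct (Hw now n n) as [v [v' [Hv [_ [_ H0]]]]].
    { split; [apply sv_refl, sv_sub, Hn|now split]. }
    exists v. auto.
Qed.

(** [B_of_V (V_of_B a)] is contained in [nucleus_jk a], so the identity is a
    morphism to [a]. *)
Lemma B_of_V_of_B I (x : I -> B) : le_B_jk (fun i => B_of_V (V_of_B (x i))) x.
Proof.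
apply le_B_jk_iff. exists Id. intros i. apply (realizes_sub (a := B_of_V (V_of_B (x i)))).
- apply le_B_iff. intros [] y y' Hy; [|exact Hy].
  destruct Hy as [Hy [Hn Hn']].
  apply at_jk in Hn as [[u [u' [-> [_ [_ Hu]]]]]|[[=] _]].
  apply at_jk in Hn' as [[v [v' [-> [_ [_ Hv]]]]]|[[=] _]].
  apply at_jk in Hy as [[z [z' [E [E' [Hz _]]]]]|[_ [[=] _]]].
  injection E as <-. injection E' as <-.
  apply at_jk. left. exists u, v. do 3 (split; [easy|]).
  intros _. split; [now apply Hu|now apply Hv].
- apply realizes_Id.
Qed.

(** One successor enters [nucleus_jk (x i)], the other one is the unit of the
    nucleus. *)
Lemma le_B_of_V_of_B I (x : I -> B) : le_B_jk x (fun i => B_of_V (V_of_B (x i))).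
Proof.
apply le_B_jk_iff. exists (Comp Succ Succ). intros i w y y' Hy.
exists (S (S y)), (S (S y')). split; [now exists (S y)|]. split; [now exists (S y')|].
apply at_jk. left. exists (S y), (S y'). do 2 (split; [reflexivity|]).
assert (Hl : forall z z', at_stage (x i) later z z' ->
  at_stage (nucleus_jk (x i)) later (S z) (S z')).
{ intros z z' Hz. apply at_jk. left. exists z, z'. now do 3 (split; [easy|]). }
split; [apply Hl, (at_stage_mono (stage_le_later w) Hy)|].
intros ->.
assert (Hn : forall z, at_stage (x i) now z z ->
  at_stage (B_of_V (V_of_B (x i))) now (S z) (S z)).
{ intros z Hz.
  assert (Hz' : at_stage (nucleus_jk (x i)) now (S z) (S z)).
  { apply at_jk. left. exists z, z. do 2 (split; [easy|]).
    split; [exact (at_stage_mono (stage_le_later now) Hz)|easy]. }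
  split; [apply Hl, (at_stage_mono (stage_le_later now) Hz)|now split]. }
split; apply Hn; [exact (at_refl_l Hy)|exact (at_refl_r Hy)].
Qed.

Lemma V_universal_implication : exists top meet imp,
  universal_implication V_le top meet imp.
Proof.
destruct nucleus_terms_jk as [b Hb].
do 3 eexists.
exact (universal_implication_transport (F := B_of_V) (G := V_of_B)
  (nucleus_universal_implication Hb) B_of_V_full B_of_V_of_B le_B_of_V_of_B).
Qed.

Theorem proposition7p13 :
  is_arrow_algebra B /\
  is_nucleus nucleus_j /\ is_nucleus nucleus_k /\ is_nucleus nucleus_jk /\
  is_arrow_algebra B_jk /\
  is_tripos (induced B_jk) /\
  equivalent V (induced B_jk) /\
  is_tripos V.
Proof.
destruct nucleus_terms_j as [bj Hj]. destruct nucleus_terms_jk as [b Hb].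
destruct V_universal_implication as [top [meet [imp HV]]].
pose proof (nucleus_universal_implication Hb) as HB.
split; [exact (nucleus_arrow_algebra nucleus_terms_id)|].
split; [apply nucleus_iff; eauto|].
split; [apply nucleus_iff; eauto using nucleus_terms_k|].
split; [apply nucleus_iff; eauto|].
split; [exact (nucleus_arrow_algebra Hb)|].
split; [exact (pointwise_tripos HB)|].
split; [|exact (pointwise_tripos HV)].
split; [exact (pointwise_preorder HV)|]. split; [exact (pointwise_preorder HB)|].
exists (fun I α i => B_of_V (α i)), (fun I x i => V_of_B (x i)).
split; [|split; [|split]].
- split; [intros I x y; apply B_of_V_full|].
  intros I J f x. split; apply (ui_refl HB).
- split; [|intros I J f x; split; apply (ui_refl HV)].
  intros I x y Hxy. apply B_of_V_full.
  exact (ui_trans HB (B_of_V_of_B _) (ui_trans HB Hxy (le_B_of_V_of_B _))).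
- intros I x. split; apply B_of_V_full; [apply B_of_V_of_B|apply le_B_of_V_of_B].
- intros I x. split; [apply B_of_V_of_B|apply le_B_of_V_of_B].
Qed.
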